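(* Let $h\in[1,n-1]$ and let $(B,\emptyset),(A,\Delta)\in\Xi_{n|n,d}$ with $\operatorname{ro}(A)=\operatorname{co}(B)$, where $B-E_{h,h+1}$ is a diagonal matrix and $\Delta=\{(i_1,j_1),\dots,(i_k,j_k)\}$. Write $A_p=A+E_{h,p}-E_{h+1,p}$. (a) If $i_t\ne h,h+1$ for all $t\in[1,k]$, then $$e_{B,\emptyset}*e_{A,\Delta}=\sum_{p\in[1,n],\,a_{h+1,p}\ge1}v^{2\sum_{j>p}a_{h,j}}\frac{v^{2(a_{h,p}+1)}-1}{v^2-1}\,e_{A_p,\Delta}.$$ (b) If there is $m$ with $i_m=h$ and $i_{m+1}\ne h+1$, then $$\begin{aligned}e_{B,\emptyset}*e_{A,\Delta}=&\sum_{p\le j_{m+1},\,a_{h+1,p}\ge1}v^{2\sum_{j>p}a_{h,j}}\tfrac{v^{2(a_{h,p}+1)}-1}{v^2-1}e_{A_p,\Delta}\\&+\sum_{p\in[j_{m+1}+1,j_m-1],\,a_{h+1,p}\ge1}v^{2(\sum_{j>p}a_{h,j}-1)}\tfrac{v^{2(a_{h,p}+1)}-1}{v^2-1}e_{A_p,\Delta}\\&+\sum_{p=j_m,\,a_{h+1,p}\ge1}v^{2\sum_{j>p}a_{h,j}}\tfrac{v^{2a_{h,p}}-1}{v^2-1}e_{A_p,\Delta}\\&+\sum_{p\in[j_m+1,n],\,a_{h+1,p}\ge1}v^{2\sum_{j>p}a_{h,j}}\tfrac{v^{2(a_{h,p}+1)}-1}{v^2-1}e_{A_p,\Delta}.\end{aligned}$$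 (c) If there is $m$ with $i_{m-1}\ne h$ and $i_m=h+1$, then $$\begin{aligned}e_{B,\emptyset}*e_{A,\Delta}=&\sum_{p\in[1,n],\,a_{h+1,p}\ge1}v^{2\sum_{j>p}a_{h,j}}\tfrac{v^{2(a_{h,p}+1)}-1}{v^2-1}e_{A_p,\Delta}+\sum_{p=j_m,\,a_{h+1,p}\ge1}v^{2\sum_{j\ge p}a_{h,j}}e_{A_p,\Delta_c}\\&+\sum_{p=j_m,\,a_{h+1,p}\ge1,\,t\in[j_{m+1}+1,j_m-1]}v^{2\sum_{j\ge p}a_{h,j}}e_{A_p,\Delta_t},\end{aligned}$$ where $\Delta_c=(\Delta\setminus\{(h+1,j_m)\})\cup\{(h,j_m)\}$ and $\Delta_t=\Delta_c\cup\{(h+1,t)\}$. (d) If there is $m$ with $i_m=h$ and $i_{m+1}=h+1$, then $$\begin{aligned}e_{B,\emptyset}*e_{A,\Delta}=&\sum_{p\in[1,j_{m+1}]\cup[j_m+1,n],\,a_{h+1,p}\ge1}v^{2\sum_{j>p}a_{h,j}}\tfrac{v^{2(a_{h,p}+1)}-1}{v^2-1}e_{A_p,\Delta}\\&+\sum_{p\in[j_{m+1}+1,j_m-1],\,a_{h+1,p}\ge1}v^{2(\sum_{j>p}a_{h,j}-1)}\tfrac{v^{2(a_{h,p}+1)}-1}{v^2-1}e_{A_p,\Delta}\\&+\sum_{p=j_m,\,a_{h+1,p}\ge1}v^{2\sum_{j>p}a_{h,j}}\tfrac{v^{2a_{h,p}}-1}{v^2-1}e_{A_p,\Delta}\\&+\sum_{p=j_{m+1},\,a_{h+1,p}\ge1}\bigl(v^{2\sum_{j\ge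 p}a_{h,j}}-v^{2(\sum_{j>p}a_{h,j}-1)}\bigr)e_{A_p,\Delta_s}\\&+\sum_{p=j_{m+1},\,a_{h+1,p}\ge1,\,t\in[j_{m+2}+1,j_{m+1}-1]}\bigl(v^{2\sum_{j\ge p}a_{h,j}}-v^{2(\sum_{j>p}a_{h,j}-1)}\bigr)e_{A_p,\Delta_t},\end{aligned}$$ where $\Delta_s=\Delta\setminus\{(h+1,j_{m+1})\}$ and $\Delta_t=\Delta_s\cup\{(h+1,t)\}$.
   Context: Let $v$ be an indeterminate, $\mathcal{A}=\mathbb{Z}[v,v^{-1}]$, $n,d$ positive integers, $[a,b]$ the set of integers between $a$ and $b$ (empty if $a>b$), $\mathbb{N}=\{0,1,\dots\}$, $E_{k,l}$ the $n\times n$ matrix units. For a prime power $q$ let $V=\mathbb{F}_q^d$, $G=GL_d(\mathbb{F}_q)$, and $\mathscr{X}$ the set of flags $(0=V_0\subseteq V_1\subseteq\cdots\subseteq V_n=V)$ (inclusions not necessarily strict). $\Xi_{n|n,d}$ is the set of decorated matrices $(A,\Delta)$: $A=(a_{ij})$ is an $n\times n$ matrix over $\mathbb{N}$ with entries summing to $d$, and $\Delta=\{(i_1,j_1),\dots,(i_k,j_k)\}$ is a (possibly empty) set of positions with $i_1<\cdots<i_k$, $j_1>\cdots>j_k$ and $a_{ij}>0$ for all $(i,j)\in\Delta$; elements of $\Delta$ are always listed in this order. $\operatorname{ro}(A)$ and $\operatorname{co}(A)$ are the vectors of row sums and column sums of $A$. The $G$-orbits on $\mathscr{X}\times\mathscr{X}\times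 V$ are the sets $\mathcal{O}_{A,\Delta}$, $(A,\Delta)\in\Xi_{n|n,d}$: $\mathcal{O}_{A,\Delta}$ consists of the triples $((V_i),(V'_j),\omega)$ for which $V$ has a basis $\{e^s_{ij}:1\le s\le a_{ij}\}$ with $V_i=\mathrm{span}\{e^s_{i'j}:i'\le i\}$, $V'_j=\mathrm{span}\{e^s_{ij'}:j'\le j\}$, $\omega=\sum_{(i,j)\in\Delta}e^1_{ij}$. $\mathcal{MS}_{n,d}=\mathcal{A}_G(\mathscr{X}\times\mathscr{X}\times V)$ is the free $\mathcal{A}$-module on the characteristic functions $e_{A,\Delta}$ of the orbits, with the convolution product $(g*h)(f,f',\omega)=\sum_{f''\in\mathscr{X},\mu\in V}g(f,f'',\mu)h(f'',f',\omega-\mu)$ in the generic sense: the structure constants are the elements of $\mathcal{A}$ which for every prime power $q$ specialize at $v=\sqrt q$ to those of this convolution. Conventions: if $\Delta$ has $k$ elements, put $j_t=0$ for $t>k$, and conditions such as $i_{m+1}\neq h+1$ or $i_{m-1}\ne h$ hold automatically when the index is outside $[1,k]$; $e_{A',\Delta'}$ is read as $0$ whenever $(A',\Delta')\notin\Xi_{n|n,d}$ (e.g. when $\Delta'$ contains a position where $A'$ has entry $0$). *)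

(* Defs.v *)
From HB Require Import structures.
#[warnings="-notation-overridden,-ambiguous-paths"]
From mathcomp Require Import all_boot all_order all_algebra all_field.
From mathcomp Require Import boolp classical_sets.

Set Implicit Arguments.
Unset Strict Implicit.
Unset Printing Implicit Defensive.

Import Order.TTheory GRing.Theory Num.Theory.
Local Open Scope ring_scope.

(** * The ring Z[v, v^-1], as a subring of the fraction field of Z[v] *)

Local Notation QQv := {fraction {poly int}}.
Local Notation "x %:F" := (tofrac x).

Definition vfrac : QQv := ('X : {poly int})%:F.

Lemma vfrac_neq0 : vfrac != 0.
Proof. by rewrite tofrac_eq0 polyX_eq0. Qed.

Definition is_laurent : {pred QQv} :=
  fun x => `[< exists k (p : {poly int}), x = p%:F / vfrac ^+ k >].

Lemma is_laurentP x :
  reflect (exists k (p : {poly int}), x = p%:F / vfrac ^+ k) (x \in is_laurent).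
Proof. exact: asboolP. Qed.

Lemma is_laurent_subring : subring_closed is_laurent.
Proof.
have v0 k : vfrac ^+ k != 0 by rewrite expf_neq0 ?vfrac_neq0.
split.
- by apply/is_laurentP; exists 0%N, 1; rewrite expr0 divr1 tofrac1.
- move=> _ _ /is_laurentP[k [p ->]] /is_laurentP[l [r ->]]; apply/is_laurentP.
  exists (k + l)%N, (p * 'X^l - r * 'X^k).
  rewrite rmorphB !rmorphM !rmorphXn /= -/vfrac exprD mulrBl.
  by rewrite -mulf_div divff // mulr1 [vfrac ^+ k * _]mulrC -mulf_div divff // mulr1.
- move=> _ _ /is_laurentP[k [p ->]] /is_laurentP[l [r ->]]; apply/is_laurentP.
  by exists (k + l)%N, (p * r); rewrite rmorphM /= exprD mulf_div.
Qed.

HB.instance Definition _ :=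
  GRing.isSubringClosed.Build QQv is_laurent is_laurent_subring.

Record laurent := Laurent { lval : QQv; lvalP : lval \in is_laurent }.

HB.instance Definition _ := [isSub for lval].
HB.instance Definition _ := [Choice of laurent by <:].
HB.instance Definition _ := [SubChoice_isSubComNzRing of laurent by <:].

Lemma vpow_subproof (z : int) : vfrac ^ z \in is_laurent.
Proof.
apply/is_laurentP; case: z => k.
- by exists 0%N, 'X^k; rewrite expr0 divr1 rmorphXn.
- by exists k.+1, 1; rewrite tofrac1 div1r NegzE -exprnN.
Qed.

Definition vpow (z : int) : laurent := Laurent (vpow_subproof z).

Lemma qnum_subproof (m : nat) :
  (vfrac ^+ (2 * m) - 1) / (vfrac ^+ 2 - 1) \in is_laurent.
Proof.
have v21 : vfrac ^+ 2 - 1 != 0.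
  rewrite -rmorphXn -tofrac1 -rmorphB tofrac_eq0 -size_poly_eq0.
  by rewrite size_XnsubC.
rewrite exprM subrX1 [X in X / _]mulrC mulfK //.
by apply: rpred_sum => i _; rewrite -exprM; apply: (vpow_subproof (2 * i)%N).
Qed.

(* (v^(2m) - 1) / (v^2 - 1); the quotient is taken in the fraction field *)
Definition qnum (m : nat) : laurent := Laurent (qnum_subproof m).

Definition laurent_repr (x : laurent) :
    {k : nat & {p : {poly int} | lval x = p%:F / vfrac ^+ k}} :=
  let: exist k kP := cid (is_laurentP _ (lvalP x)) in existT _ k (cid kP).

(* The value of x at v := s, meaningful for s != 0. *)
Definition leval (s : algC) (x : laurent) : algC :=
  let: existT k (exist p _) := laurent_repr x in
  (map_poly (intr : int -> algC) p).[s] / s ^+ k.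

(* leval does not depend on the presentation p / v^k of x *)
Lemma levalE (s : algC) (x : laurent) k (p : {poly int}) : s != 0 ->
  lval x = p%:F / vfrac ^+ k ->
  leval s x = (map_poly (intr : int -> algC) p).[s] / s ^+ k.
Proof.
move=> s0 xE; rewrite /leval; case: (laurent_repr x) => l [r xE'].
have v0 j : vfrac ^+ j != 0 by rewrite expf_neq0 ?vfrac_neq0.
have /eqP : r%:F / vfrac ^+ l = p%:F / vfrac ^+ k by rewrite -xE'.
rewrite eqr_div // -!rmorphXn -!rmorphM /= tofrac_eq => /eqP rp.
have /(congr1 (fun u => (map_poly (intr : int -> algC) u).[s])) := rp.
rewrite !rmorphM !rmorphXn /= !map_polyX !hornerM !hornerXn => rps.
by apply/eqP; rewrite eqr_div ?expf_neq0 // rps.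
Qed.

(** * Decorated matrices *)

(* Rows and columns are indexed by 'I_n = {0, ..., n-1}; the 1-based number
   of the index i is i.+1. *)

Section DecoratedMatrices.
Variable n : nat.
Implicit Types (A : 'M[nat]_n) (D : {set 'I_n * 'I_n}).

Definition ro A : 'rV[nat]_n := \row_i (\sum_j A i j)%N.
Definition co A : 'rV[nat]_n := \row_j (\sum_i A i j)%N.

(* (i_1, j_1), ..., (i_k, j_k) *)
Definition dlist D : seq ('I_n * 'I_n) :=
  sort (fun x y : 'I_n * 'I_n => (x.1 <= y.1)%N) (enum D).

(* The 1-based i_t and j_t for 1 <= t <= k, and 0 for every other t; as row
   numbers are positive, 0 differs from all of them. *)
Definition irow D (t : nat) : nat := nth 0%N (0%N :: [seq x.1.+1 | x : 'I_n * 'I_n <- dlist D]) t.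
Definition jcol D (t : nat) : nat := nth 0%N (0%N :: [seq x.2.+1 | x : 'I_n * 'I_n <- dlist D]) t.

Definition in_Xi (d : nat) (X : 'M[nat]_n * {set 'I_n * 'I_n}) : bool :=
  [&& (\sum_i \sum_j X.1 i j)%N == d,
      sorted (fun x y : 'I_n * 'I_n => (x.1 < y.1)%N && (y.2 < x.2)%N) (dlist X.2)
    & [forall x in X.2, (0 < X.1 x.1 x.2)%N]].

(* A + E_{h,p} - E_{h',p}, for a_{h',p} >= 1 (with truncated subtraction) *)
Definition shift_mx A (h h' p : 'I_n) : 'M[nat]_n :=
  \matrix_(i, j) (A i j + ((i == h) && (j == p)) - ((i == h') && (j == p)))%N.

Definition sum_gt A (h p : 'I_n) : nat := (\sum_(j < n | (p < j)%N) A h j)%N.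
Definition sum_ge A (h p : 'I_n) : nat := (\sum_(j < n | (p <= j)%N) A h j)%N.

End DecoratedMatrices.

Record Xi (n d : nat) := XiOf {
  xi_val : 'M[nat]_n * {set 'I_n * 'I_n};
  xi_valP : in_Xi d xi_val }.

HB.instance Definition _ n d := [isSub for @xi_val n d].
HB.instance Definition _ n d := [Countable of Xi n d by <:].

Section XiFinite.
Variables n d : nat.

Definition xi_code (X : Xi n d) : 'M['I_d.+1]_n * {set 'I_n * 'I_n} :=
  (map_mx inord (val X).1, (val X).2).
Definition xi_decode (Y : 'M['I_d.+1]_n * {set 'I_n * 'I_n}) : option (Xi n d) :=
  insub (map_mx (@nat_of_ord _) Y.1, Y.2).

Lemma xi_codeK : pcancel xi_code xi_decode.
Proof.
move=> X; rewrite /xi_decode /xi_code /=.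
suff -> : (map_mx (@nat_of_ord d.+1) (map_mx inord (val X).1), (val X).2) = val X.
  exact: valK.
case: X => [[A D] AD] /=; case/and3P: (AD) => /= /eqP dA _ _.
suff -> : map_mx (@nat_of_ord d.+1) (map_mx inord A) = A :> 'M[nat]_n by [].
apply/matrixP => i j; rewrite !mxE inordK // ltnS -dA.
by rewrite (bigD1 i) //= (bigD1 j) //= -addnA leq_addr.
Qed.

HB.instance Definition _ : isFinite (Xi n d) := PCanIsFinite xi_codeK.

End XiFinite.

(** * Flags and orbits over a finite field *)

HB.instance Definition _ (F : finFieldType) (vT : vectType F) :=
  CanIsCountable (@VectorInternalTheory.vs2mxK F vT).
HB.instance Definition _ (F : finFieldType) (vT : vectType F) :
    isFinite {vspace vT} :=
  CanIsFinite (@VectorInternalTheory.vs2mxK F vT).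

Section Flags.
Variables (F : finFieldType) (n d : nat).

Definition is_flag (f : {ffun 'I_n.+1 -> {vspace 'rV[F]_d}}) : bool :=
  [&& f ord0 == 0%VS, f ord_max == fullv
    & [forall i : 'I_n.+1, forall j : 'I_n.+1, (i <= j)%N ==> (f i <= f j)%VS]].

Record flag := Flag {
  flag_val :> {ffun 'I_n.+1 -> {vspace 'rV[F]_d}};
  flag_valP : is_flag flag_val }.

HB.instance Definition _ := [isSub for flag_val].
HB.instance Definition _ := [Finite of flag by <:].

(* The indices ((i, j), s) with 1 <= s <= a_ij. *)
Definition cells (A : 'M[nat]_n) : seq ('I_n * 'I_n * nat) :=
  [seq (ij, s) | ij <- enum {: 'I_n * 'I_n}, s <- iota 1 (A ij.1 ij.2)].

(* (f, f', w) lies in O_{A,D}. As rows and columns are counted from 0, the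
   condition (i'.+1 <= i) of the 1-based numbering reads (i' < i). *)
Definition in_orbit (A : 'M[nat]_n) (D : {set 'I_n * 'I_n})
    (f f' : flag) (w : 'rV[F]_d) : Prop :=
  exists e : 'I_n * 'I_n * nat -> 'rV[F]_d,
    [/\ basis_of fullv [seq e c | c <- cells A],
        forall i : 'I_n.+1,
          f i = <<[seq e c | c : 'I_n * 'I_n * nat <- cells A & (c.1.1 < i)%N]>>%VS,
        forall j : 'I_n.+1,
          f' j = <<[seq e c | c : 'I_n * 'I_n * nat <- cells A & (c.1.2 < j)%N]>>%VS
      & w = \sum_(x in D) e (x, 1%N)].

Definition chi (X : Xi n d) (f f' : flag) (w : 'rV[F]_d) : algC :=
  `[< in_orbit (val X).1 (val X).2 f f' w >]%:R.

Definition convolution (g h : flag -> flag -> 'rV[F]_d -> algC)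
    (f f' : flag) (w : 'rV[F]_d) : algC :=
  \sum_(f'' : flag) \sum_(mu : 'rV[F]_d) g f f'' mu * h f'' f' (w - mu).

End Flags.

(** * The generic convolution algebra MS_{n,d} *)

Definition MS (n d : nat) := {ffun Xi n d -> laurent^o}.

Section MSAlgebra.
Variables n d : nat.

HB.instance Definition _ := GRing.Lmodule.on (MS n d).

(* 0 when (A, D) is not a decorated matrix of size d *)
Definition ebasis (A : 'M[nat]_n) (D : {set 'I_n * 'I_n}) : MS n d :=
  [ffun X : Xi n d => ((val X == (A, D))%:R : laurent)].

(* c is the family of structure constants of e_X * e_Y: for every finite field
   F, the evaluation of c at v = sqrt #|F| gives the expansion of the
   convolution of the characteristic functions over F. *)
Definition generic_product (X Y : Xi n d) (c : MS n d) : Prop :=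
  forall (F : finFieldType) (f f' : flag F n d) (w : 'rV[F]_d),
    convolution (@chi F n d X) (@chi F n d Y) f f' w
    = \sum_(Z : Xi n d) leval (sqrtC #|F|%:R) (c Z) * chi Z f f' w.

(* The element with these structure constants, which is unique because the
   orbits are nonempty and pairwise disjoint and there are infinitely many
   prime powers; the default 0 is used only if there is none. *)
Definition basis_mul (X Y : Xi n d) : MS n d := xget 0 (generic_product X Y).

Definition ms_mul (x y : MS n d) : MS n d :=
  \sum_(X : Xi n d) \sum_(Y : Xi n d) ((x X : laurent) * (y Y : laurent)) *: basis_mul X Y.

End MSAlgebra.

Arguments ebasis {n} d A D.

(* Main.v *)
Require Import Defs.
From mathcomp Require Import all_boot all_order all_algebra all_field.
From mathcomp Require Import boolp.
From mathcomp Require classical_sets.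
From mathcomp Require Import zify ring lra.

(** As the decoration of [B] is empty, the value of [e_B * e_(A,D)] at a triple
    [(f, f', w)] is the number of flags [g] such that [(f, g)] has type [B] and
    [(g, f', w)] lies in the orbit of [(A, D)]. Rows are counted from 0, so the row
    [h] lies between the steps [h] and [h1 = h + 1] of a flag. Since [B - E_(h,h1)]
    is diagonal, [g] differs from [f] only in its step [h1], which is a hyperplane
    [H] of [f_h1] containing [f_h] ([position_elementary]). The coefficients are
    numbers of such hyperplanes.

    An orbit is described by two invariants: the dimensions of the [f_i cap f'_j],
    which give the matrix, and the staircase [J], where [J i] is the least [j] with
    [w] in [f_i + f'_j]; the cells of the decoration are the descents of [J]
    ([in_orbitP], [position_exists], [position_uniq]). Replacing [f_h1] by [H]
    lowers the dimension of [f_h1 cap f'_j] exactly for the [j] beyond some column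
    [p], so the matrix of the triple is [A + E_(h,p) - E_(h1,p)] ([lowers_shift]).
    The staircase changes only at [h1]. Write [w = u + y] with [u] in [f_h1] and [y]
    in [f'_c0], where [c0 = J h1]. If [p < c0] or [u] lies in [H], the value at [h1]
    remains [c0]; otherwise it becomes [p + 1] ([jump_stair]).

    It remains to count the [H] containing one subspace but not another one, with
    or without the condition that [u] lies in [H]. A subspace of codimension [r] is
    contained in [1 + q + ... + q^(r-1)] hyperplanes ([card_hyper]), the subspaces
    that occur have codimensions given by the row [h] of [A] ([dim_layer]), and [u]
    lowers them by one before the column [J h] ([dim_layer_line]). The result is
    [card_lowering].

    Structure constants are determined by their values at the square roots of
    primes ([laurent_eq]), so both sides of each formula need only be compared orbit
    by orbit ([product_eq]). A decoration [D'] contributes in two ways: it equals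
    [D], or the staircase of [D] at [h1] is [p + 1] and that of [D'] is lower. In the
    second case [D'] is [D] without [(h1, p)], with the cell of row [h] added if it
    is missing and possibly with one new cell in row [h1] ([lowered_sum]). *)

Set Implicit Arguments.
Unset Strict Implicit.
Unset Printing Implicit Defensive.

Import Order.TTheory GRing.Theory Num.Theory.
Local Open Scope ring_scope.

(** * Staircases of decorations *)

Section Staircases.
Variable n : nat.
Implicit Types (D : {set 'I_n * 'I_n}) (x y : 'I_n * 'I_n).

(** For the antichain of a decoration this is 1 + the column of the first cell of
    [D] in row [i] or below, and 0 if there is none. On the orbit of [(A, D)] it
    is the least [j] with [w] in [V_i + V'_j]. *)
Definition stair D (i : nat) : nat := (\max_(x in D | (i <= x.1)%N) x.2.+1)%N.

Lemma stair_leP D i j :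
  reflect (forall x, x \in D -> (i <= x.1)%N -> (x.2 < j)%N) (stair D i <= j)%N.
Proof.
apply: (iffP idP) => [le x xD ix | H].
  apply: leq_trans le; rewrite /stair.
  by apply: (@leq_bigmax_cond _ (fun x => (x \in D) && (i <= x.1)%N)
    (fun x => x.2.+1)); rewrite xD.
by apply/bigmax_leqP => x /andP[xD ix]; apply: H.
Qed.

Lemma stair_mono D i j : (i <= j)%N -> (stair D j <= stair D i)%N.
Proof.
move=> ij; apply/stair_leP => x xD jx.
by move: (leqnn (stair D i)) => /stair_leP; apply => //; apply: leq_trans jx.
Qed.

Lemma stair_ltn D x : x \in D -> forall i, (i <= x.1)%N -> (x.2 < stair D i)%N.
Proof. by move=> xD i ix; move: (leqnn (stair D i)) => /stair_leP; apply. Qed.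

Lemma stair_out D i : (n <= i)%N -> stair D i = 0%N.
Proof.
move=> ni; apply/eqP; rewrite -leqn0; apply/stair_leP => x _ ix.
by move: (leq_trans ni ix); rewrite leqNgt ltn_ord.
Qed.

Lemma stair_le D i : (stair D i <= n)%N.
Proof. by apply/stair_leP => x _ _; apply: ltn_ord. Qed.

Lemma stair_attained D i : (0 < stair D i)%N ->
  exists x, [/\ x \in D, (i <= x.1)%N & stair D i = x.2.+1].
Proof.
move=> J0; case: (boolP [exists x in D, (i <= x.1)%N && (stair D i == x.2.+1)]).
  by case/existsP=> x /andP[xD /andP[ix /eqP E]]; exists x.
rewrite negb_exists => /forallP H; exfalso.
suff: (stair D i <= (stair D i).-1)%N by lia.
apply/stair_leP => x xD ix; have := H x; rewrite xD ix /= => /eqP ne.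
by have := stair_ltn xD ix; lia.
Qed.

Definition antichain D := forall x y, x \in D -> y \in D -> (x.1 <= y.1)%N ->
  x = y \/ ((x.1 < y.1)%N /\ (y.2 < x.2)%N).

(** The cells of an antichain are the descents of its staircase. Hence an
    antichain is determined by its staircase. *)
Lemma antichain_mem D x : antichain D ->
  (x \in D) = (stair D x.1.+1 <= x.2)%N && (stair D x.1 == x.2.+1).
Proof.
move=> aD; apply/idP/idP => [xD|/andP[le /eqP E]].
  apply/andP; split.
    apply/stair_leP => y yD xy.
    by case: (aD x y xD yD (ltnW xy)) => [E|[] //]; move: xy; rewrite E ltnn.
  rewrite eqn_leq (stair_ltn xD) // andbT.
  apply/stair_leP => y yD xy.
  by case: (aD x y xD yD xy) => [-> //|[_ /ltnW]].
have [|y [yD xy yE]] := @stair_attained D x.1; first by rewrite E.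
have := xy; rewrite leq_eqVlt => /orP[/eqP e1|lt1]; last first.
  by have := stair_ltn yD lt1; lia.
suff -> : x = y by [].
case: x E le e1 xy yE => x1 x2 /= E le e1 _ yE; case: y yD e1 yE => y1 y2 /= _ e1 yE.
by congr (_, _); apply: val_inj => //=; lia.
Qed.

Lemma stair_inj D E : antichain D -> antichain E -> stair D =1 stair E -> D = E.
Proof. by move=> aD aE JE; apply/setP => x; rewrite !antichain_mem // !JE. Qed.

Definition lt_cell : rel ('I_n * 'I_n) := fun x y => (x.1 < y.1)%N && (y.2 < x.2)%N.

Lemma lt_cell_trans : transitive lt_cell.
Proof. by move=> y x z /andP[a b] /andP[c e]; rewrite /lt_cell; lia. Qed.

Lemma mem_dlist D x : (x \in dlist D) = (x \in D).
Proof. by rewrite mem_sort mem_enum. Qed.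

Lemma size_dlist D : size (dlist D) = #|D|.
Proof. by rewrite size_sort cardE. Qed.

Lemma dlist_antichain D : sorted lt_cell (dlist D) <-> antichain D.
Proof.
split=> [sD x y|aD].
  rewrite -!mem_dlist => xD yD xy.
  have [|ne] := eqVneq x y; [by left | right].
  have ltn : forall a b, a \in dlist D -> b \in dlist D ->
     (index a (dlist D) < index b (dlist D))%N -> lt_cell a b.
    move=> a b aD bD iab; rewrite -(nth_index a aD) -(nth_index a bD).
    by apply: (sorted_ltn_nth lt_cell_trans) => //; rewrite inE index_mem.
  case: (ltngtP (index x (dlist D)) (index y (dlist D))) => [lt|lt|E].
  - by have := ltn _ _ xD yD lt; move/andP.
  - by have := ltn _ _ yD xD lt; rewrite /lt_cell; lia.
  - by rewrite -(nth_index x xD) E (nth_index x yD) eqxx in ne.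
have st : sorted (fun x y : 'I_n * 'I_n => (x.1 <= y.1)%N) (dlist D).
  by apply: sort_sorted => x y /=; apply: leq_total.
have tr : transitive (fun x y : 'I_n * 'I_n => (x.1 <= y.1)%N).
  by move=> y x z /=; apply: leq_trans.
have un : uniq (dlist D) by rewrite sort_uniq enum_uniq.
have sub : {subset dlist D <= D} by move=> x; rewrite mem_dlist.
move: (dlist D) st un sub => [|x s] //= st /andP[xs un] sub.
elim: s x xs st un sub => //= y s IH x xs /andP[xy ys] /andP[yns un] sub.
have xD : x \in D by apply: sub; rewrite !inE eqxx.
have yD : y \in D by apply: sub; rewrite !inE eqxx orbT.
apply/andP; split; last first.
  by apply: IH => // z zs; apply: sub; rewrite in_cons zs orbT.
case: (aD x y xD yD xy) => [E|[a b]]; last by rewrite /lt_cell a b.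
by move: xs; rewrite E inE eqxx.
Qed.

Lemma irow_jcol D m (x0 : 'I_n * 'I_n) : (1 <= m <= #|D|)%N ->
  let x := nth x0 (dlist D) m.-1 in
  [/\ x \in D, irow D m = x.1.+1 & jcol D m = x.2.+1].
Proof.
case: m => //= m; rewrite -size_dlist => mD.
split; first by rewrite -mem_dlist mem_nth.
  by rewrite /irow /= (nth_map x0).
by rewrite /jcol /= (nth_map x0).
Qed.

Lemma irow_lt D s t : antichain D -> (1 <= s)%N -> (s < t <= #|D|)%N ->
  (irow D s < irow D t)%N /\ (jcol D t < jcol D s)%N.
Proof.
move/dlist_antichain => sD s1 /andP[st tD].
have [x0 _] : exists x0 : 'I_n * 'I_n, true.
  have : (0 < #|D|)%N by lia.
  by case/card_gt0P=> x0 _; exists x0.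
have [|_ -> ->] := @irow_jcol D s x0; first by lia.
have [|_ -> ->] := @irow_jcol D t x0; first by lia.
have := @sorted_ltn_nth _ _ lt_cell_trans x0 _ sD s.-1 t.-1.
by rewrite !inE size_dlist /lt_cell => /(_ _ _ _) /andP; rewrite !ltnS; apply; lia.
Qed.

Lemma irow_mem D x : x \in D ->
  exists m, [/\ (1 <= m <= #|D|)%N, irow D m = x.1.+1 & jcol D m = x.2.+1].
Proof.
rewrite -mem_dlist => xD; have lt : (index x (dlist D) < #|D|)%N.
  by rewrite -size_dlist index_mem.
exists (index x (dlist D)).+1.
by have [//|_ -> ->] := @irow_jcol D (index x (dlist D)).+1 x; rewrite /= nth_index.
Qed.

Lemma irow_out D m : irow D m <> 0%N -> (1 <= m <= #|D|)%N.
Proof.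
case: m => //= m ne; rewrite ltnNge; apply/negP; rewrite -size_dlist => le.
by apply: ne; rewrite /irow /= nth_default // size_map.
Qed.

Lemma jcol_out D m : (#|D| < m)%N -> jcol D m = 0%N.
Proof.
by case: m => //= m; rewrite -size_dlist => le; rewrite /jcol /= nth_default ?size_map.
Qed.

(** The list is sorted by rows and has at most one cell per row, so the first cell
    below the [m]-th one comes next in the list; when [m] is the last position both
    sides of the third conjunct are the default value 0. *)
Lemma stair_irow D m i : antichain D -> (1 <= m <= #|D|)%N -> irow D m = i.+1 ->
  [/\ (i < n)%N, stair D i = jcol D m, stair D i.+1 = jcol D m.+1
    & (jcol D m.+1 < jcol D m)%N].
Proof.
move=> aD mD mi.
have [x0 _] : exists x0 : 'I_n * 'I_n, true.
  have : (0 < #|D|)%N by lia.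
  by case/card_gt0P=> x0 _; exists x0.
have [//|] := @irow_jcol D m x0; set x := nth _ _ _ => xD xi xj.
have Ei : i = x.1 by move: mi; rewrite xi => -[].
split; first by rewrite Ei ltn_ord.
- by move: xD; rewrite antichain_mem // xj Ei => /andP[_ /eqP].
- apply/eqP; rewrite eqn_leq; apply/andP; split.
    apply/stair_leP => y /irow_mem[t [tD ty <-]] iy.
    have mt : (m < t)%N.
      rewrite ltnNge; apply/negP => tm; have : (irow D t <= irow D m)%N; last by lia.
      have [->//|ne] := eqVneq t m.
      by have [] := @irow_lt D t m aD _ _; lia.
    have [->//|ne] := eqVneq m.+1 t.
    by have [] := @irow_lt D m.+1 t aD _ _; lia.
  have [mD'|] := leqP m.+1 #|D|; last by move/jcol_out->.
  have [|yD yi ->] := @irow_jcol D m.+1 x0; first by lia.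
  apply: stair_ltn => //; rewrite -ltnS -yi -mi.
  by have [] := @irow_lt D m m.+1 aD _ _; lia.
- have [mD'|] := leqP m.+1 #|D|; last by move/jcol_out->; rewrite xj.
  by have [] := @irow_lt D m m.+1 aD _ _; lia.
Qed.

Lemma stair_const D (i : 'I_n) : antichain D ->
  (forall t, (1 <= t <= #|D|)%N -> irow D t <> i.+1) -> stair D i = stair D i.+1.
Proof.
move=> aD H; apply/eqP; rewrite eqn_leq [X in _ && X]stair_mono // andbT.
apply/stair_leP => y yD iy; apply: stair_ltn => //.
rewrite ltn_neqAle iy andbT; apply/eqP => E.
by have [t [tD ti _]] := irow_mem yD; apply: (H t tD); rewrite ti -E.
Qed.

(** Two consecutive entries of the increasing list of rows leave no room for a
    row between them; the same argument gives [irow_prev]. *)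
Lemma irow_next D m i : antichain D -> (1 <= m <= #|D|)%N -> irow D m = i.+1 ->
  irow D m.+1 <> i.+2 -> forall t, (1 <= t <= #|D|)%N -> irow D t <> i.+2.
Proof.
move=> aD mD mi mi1 t tD ti.
have [Em|ne] := eqVneq t m.+1; first by rewrite -Em in mi1.
have [tm|mt] := leqP t m.
  have [E|ne'] := eqVneq t m; first by rewrite E mi in ti; lia.
  by have [] := @irow_lt D t m aD _ _; lia.
have [||] := @irow_lt D m m.+1 aD; [lia|lia|].
by have [||] := @irow_lt D m.+1 t aD; lia.
Qed.

Lemma irow_prev D m i : antichain D -> (1 <= m <= #|D|)%N -> irow D m = i.+2 ->
  irow D m.-1 <> i.+1 -> forall t, (1 <= t <= #|D|)%N -> irow D t <> i.+1.
Proof.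
move=> aD mD mi mi1 t tD ti.
have [Em|ne] := eqVneq t m.-1; first by rewrite -Em in mi1.
have [mt|tm] := leqP m t.
  have [E|ne'] := eqVneq t m; first by rewrite E mi in ti; lia.
  by have [] := @irow_lt D m t aD _ _; lia.
have [||] := @irow_lt D m.-1 m aD; [lia|lia|].
by have [||] := @irow_lt D t m.-1 aD; lia.
Qed.

(** Converse of [antichain_mem]: the descents of a nonincreasing function form an
    antichain. *)
Lemma stair_set (J : nat -> nat) :
  (forall i j, (i <= j)%N -> (J j <= J i)%N) -> (forall i, (n <= i)%N -> J i = 0%N) ->
  (J 0%N <= n)%N ->
  let D := [set x : 'I_n * 'I_n | (J x.1.+1 <= x.2)%N && (J x.1 == x.2.+1)] in
  antichain D /\ stair D =1 J.
Proof.
move=> Jm Jn J0 D; have Dm x : x \in D -> (J x.1.+1 <= x.2)%N /\ J x.1 = x.2.+1.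
  by rewrite inE => /andP[a /eqP].
split.
  move=> x y /Dm[x1 x2] /Dm[y1 y2]; rewrite leq_eqVlt => /orP[/eqP E|lt].
    left; case: x y E x1 x2 y1 y2 => [x1 x2] [y1 y2] /= E _ H _ H'.
    by congr (_, _); apply: val_inj => //=; move: H; rewrite E H' => -[].
  by right; split => //; have := Jm _ _ lt; lia.
move=> i; apply/eqP; rewrite eqn_leq; apply/andP; split.
  by apply/stair_leP => x /Dm[x1 x2] ix; rewrite -x2; apply: Jm.
have [/Jn->//|lt] := leqP n i.
have [m E] : exists m, (m + i = n)%N by exists (n - i)%N; lia.
elim: m i E {lt} => [|m IH] i E; first by rewrite Jn //; lia.
have lti : (i < n)%N by lia.
have := Jm i i.+1 (leqnSn i); rewrite leq_eqVlt => /orP[/eqP<-|lt].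
  by apply: leq_trans (IH i.+1 _) (stair_mono _ _) => //; lia.
have ltj : ((J i).-1 < n)%N by have := Jm 0%N i isT; lia.
have xD : (Ordinal lti, Ordinal ltj) \in D by rewrite inE /=; lia.
by have := stair_ltn xD (leqnn i) => /=; lia.
Qed.

End Staircases.

Section AgreeOff.
Variables (n : nat) (h1 : 'I_n).
Implicit Types (D E : {set 'I_n * 'I_n}).

(** Lowering the step [h1] of a flag leaves the sums of the other steps with
    [V'_j] unchanged, so it can change the staircase only at [h1]. *)
Definition agree_off D E :=
  [forall i : 'I_n.+1, (i != h1 :> nat) ==> (stair D i == stair E i)].

Lemma agree_offP D E :
  reflect (forall i : nat, i <> h1 -> stair D i = stair E i) (agree_off D E).
Proof.
apply: (iffP forallP) => [H i /eqP ne|H i].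
  have [ni|ni] := ltnP i n.+1; last by rewrite !stair_out // ltnW.
  by have /implyP/(_ ne)/eqP := H (Ordinal ni).
by apply/implyP => /eqP ne; apply/eqP; apply: H.
Qed.

Lemma agree_off_eq D E : antichain D -> antichain E ->
  (agree_off D E && (stair D h1 == stair E h1)) = (E == D).
Proof.
move=> aD aE; apply/andP/eqP => [[/agree_offP eqDE /eqP eq1]|->]; last first.
  by split=> //; apply/agree_offP.
by apply/esym/stair_inj => // i; have [->|/eqP/eqDE] := eqVneq i h1.
Qed.

Lemma agree_off_next (h : 'I_n) D E : h1 = h.+1 :> nat -> agree_off D E ->
  (stair D h1.+1 <= stair E h1)%N /\ stair E h = stair D h.
Proof.
move=> h1E /agree_offP eqDE; split; last by apply/esym/eqDE; lia.
by rewrite (eqDE h1.+1) ?stair_mono //; lia.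
Qed.

End AgreeOff.

(** * Evaluation of Laurent polynomials *)

Section Evaluation.

Local Notation "x %:F" := (tofrac x).

Lemma vfracX_neq0 k : vfrac ^+ k != 0.
Proof. by rewrite expf_neq0 // vfrac_neq0. Qed.

Lemma lval_repr (x : laurent) : exists k (p : {poly int}), lval x = p%:F / vfrac ^+ k.
Proof. exact/is_laurentP/lvalP. Qed.

Variable s : algC.
Hypothesis s0 : s != 0.
Let sX0 k : s ^+ k != 0. Proof. exact: expf_neq0. Qed.

Lemma levalD (x y : laurent) : leval s (x + y) = leval s x + leval s y.
Proof.
have [k [p xE]] := lval_repr x; have [l [r yE]] := lval_repr y.
rewrite (levalE s0 xE) (levalE s0 yE).
have xyE : lval (x + y) = (p * 'X^l + r * 'X^k)%:F / vfrac ^+ (k + l).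
  rewrite rmorphD !rmorphM !rmorphXn /= -/vfrac exprD mulrDl.
  rewrite -mulf_div divff ?vfracX_neq0 // mulr1.
  by rewrite [vfrac ^+ k * _]mulrC -mulf_div divff ?vfracX_neq0 // mulr1 -xE -yE.
rewrite (levalE s0 xyE) !rmorphD !rmorphM !rmorphXn /= map_polyX.
rewrite hornerD !hornerM !hornerXn exprD mulrDl.
rewrite -mulf_div divff // mulr1.
by rewrite [s ^+ k * _]mulrC -mulf_div divff // mulr1.
Qed.

Lemma levalM (x y : laurent) : leval s (x * y) = leval s x * leval s y.
Proof.
have [k [p xE]] := lval_repr x; have [l [r yE]] := lval_repr y.
rewrite (levalE s0 xE) (levalE s0 yE).
have xyE : lval (x * y) = (p * r)%:F / vfrac ^+ (k + l).
  by rewrite rmorphM exprD -mulf_div -xE -yE.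
by rewrite (levalE s0 xyE) rmorphM hornerM exprD mulf_div.
Qed.

Lemma leval_poly (x : laurent) (p : {poly int}) :
  lval x = p%:F -> leval s x = (map_poly (intr : int -> algC) p).[s].
Proof. by move=> xE; rewrite (@levalE s x 0%N p) // ?expr0 divr1. Qed.

Lemma leval0 : leval s 0 = 0.
Proof. by rewrite (@leval_poly 0 0) ?rmorph0 ?horner0. Qed.

Lemma leval1 : leval s 1 = 1.
Proof. by rewrite (@leval_poly 1 1) ?rmorph1 ?hornerE. Qed.

Lemma levalB (x y : laurent) : leval s (x - y) = leval s x - leval s y.
Proof. by apply/eqP; rewrite eq_sym subr_eq -levalD subrK. Qed.

Lemma leval_bool (b : bool) : leval s b%:R = b%:R.
Proof. by case: b; rewrite (leval0, leval1). Qed.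

Lemma leval_vpow (z : int) : leval s (vpow z) = s ^ z.
Proof.
case: z => k.
  by rewrite (@leval_poly _ 'X^k) /= ?rmorphXn //= map_polyX hornerXn.
by rewrite (@levalE s _ k.+1 1) ?rmorph1 /= ?hornerE ?NegzE ?exprnN ?div1r //.
Qed.

Lemma leval_qnum (m : nat) : leval s (qnum m) = \sum_(i < m) (s ^+ 2) ^+ i.
Proof.
have v21 : vfrac ^+ 2 - 1 != 0.
  rewrite -rmorphXn -tofrac1 -rmorphB tofrac_eq0 -size_poly_eq0.
  by rewrite size_XnsubC.
rewrite (@leval_poly _ (\sum_(i < m) 'X^(2 * i))); last first.
  rewrite /= exprM subrX1 [X in X / _]mulrC mulfK // rmorph_sum.
  by apply: eq_bigr => i _; rewrite rmorphXn /= exprM.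
rewrite rmorph_sum horner_sum; apply: eq_bigr => i _.
by rewrite rmorphXn /= map_polyX hornerXn exprM.
Qed.

End Evaluation.

Lemma sqrtC_nat_neq0 q : (1 < q)%N -> sqrtC q%:R != 0 :> algC.
Proof. by move=> q1; rewrite sqrtC_eq0 pnatr_eq0; lia. Qed.

(** A Laurent polynomial vanishing at the square root of every prime has a
    numerator with infinitely many roots. *)
Lemma laurent_eq (x y : laurent) :
  (forall p, prime p -> leval (sqrtC p%:R) x = leval (sqrtC p%:R) y) -> x = y.
Proof.
move=> H; apply/eqP; rewrite -subr_eq0; apply/eqP; set z := x - y.
have [k [r zE]] := lval_repr z.
have s0 p : prime p -> sqrtC p%:R != 0 :> algC.
  by move=> /prime_gt1; apply: sqrtC_nat_neq0.
have rz p : prime p -> root (map_poly (intr : int -> algC) r) (sqrtC p%:R).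
  move=> pp; have := levalE (s0 p pp) zE; rewrite levalB ?s0 // H // subrr.
  move/esym/eqP; rewrite mulf_eq0 invr_eq0 expf_eq0 (negPf (s0 p pp)) andbF orbF.
  by move/eqP=> E; apply/rootP.
suff r0 : r = 0 by apply: val_inj; rewrite [LHS]zE r0 rmorph0 mul0r.
apply/eqP; apply: contraT => rn0.
have inf N : exists ps : seq nat, [/\ uniq ps, all prime ps & size ps = N].
  elim: N => [|N [ps [ups pps sps]]]; first by exists [::].
  have [p mp pp] := prime_above (\max_(i <- ps) i).
  exists (p :: ps); split=> //=; last by rewrite sps.
    rewrite ups andbT; apply/negP => pin.
    by move: mp; rewrite ltnNge (@leq_bigmax_seq _ ps xpredT id).
  by rewrite pp.
have rn0' : map_poly (intr : int -> algC) r != 0.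
  by rewrite map_poly_eq0_id0 // intr_eq0 lead_coef_eq0.
have [ps [ups pps sps]] := inf (size (map_poly (intr : int -> algC) r)).
have := @max_poly_roots _ _ [seq sqrtC p%:R : algC | p <- ps] rn0' _ _.
rewrite size_map sps ltnn; apply.
  by apply/allP => _ /mapP[p pin ->]; apply/rz/(allP pps).
rewrite map_inj_uniq // => p q /(congr1 (fun z => z ^+ 2)).
by rewrite !sqrtCK => /eqP; rewrite eqr_nat => /eqP.
Qed.

(** * Counting hyperplanes *)

Definition geom (q r : nat) : nat := (\sum_(i < r) q ^ i)%N.

Lemma geomD q m k : (geom q (m + k) = geom q m + q ^ m * geom q k)%N.
Proof.
rewrite /geom big_split_ord /= big_distrr /=; congr (_ + _)%N.
by apply: eq_bigr => i _; rewrite expnD.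
Qed.

Section Hyperplanes.
Variables (F : finFieldType) (d : nat).
Local Notation V := 'rV[F]_d.
Local Notation q := #|F|.
Implicit Types (X Y U H : {vspace V}) (u v w : V).

Lemma card_vs U : #|[set v in U]| = (q ^ \dim U)%N.
Proof. by rewrite cardsE card_vspace. Qed.

Definition hyper X U :=
  [set H : {vspace V} | [&& (X <= H)%VS, (H <= U)%VS & (\dim H).+1 == \dim U]].

Lemma hyper_line X U u : u \in U ->
  [set H in hyper X U | u \in H] = hyper (X + <[u]>)%VS U.
Proof.
by move=> uU; apply/setP => H; rewrite !inE subv_add -memvE andbAC !andbA.
Qed.

Lemma geom_rat r : (geom q r)%:R * (q%:R - 1) = q%:R ^+ r - 1 :> rat.
Proof.
rewrite subrX1 mulrC /geom natr_sum; congr (_ * _).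
by apply: eq_bigr => i _; rewrite natrX.
Qed.

Lemma dim_add_line X u : u \notin X -> \dim (X + <[u]>) = (\dim X).+1.
Proof.
move=> uX; apply/eqP; rewrite eqn_leq; apply/andP; split.
  apply: leq_trans (dimv_add_leqif _ _) _.
  by rewrite dim_vline; case: (u != 0); rewrite ?addn1 ?addn0.
have /ltn_leqif -> := dimv_leqif_sup (addvSl X <[u]>%VS).
by apply: contra uX => /subvP; apply; rewrite memvE addvSr.
Qed.

Lemma card_notin U H : (H <= U)%VS ->
  #|[set u in U | u \notin H]| = (q ^ \dim U - q ^ \dim H)%N.
Proof.
move=> HU; rewrite -!card_vs.
have sub : [set v in H] \subset [set v in U].
  by apply/subsetP => v; rewrite !inE; apply/subvP.
rewrite -cardsDS //; apply: eq_card => v.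
by rewrite !inE andbC.
Qed.

(** By induction on the codimension of [X], counting in two ways the pairs of a
    hyperplane and a vector of [U] outside it. *)
Lemma card_hyper X U : (X <= U)%VS -> #|hyper X U| = geom q (\dim U - \dim X).
Proof.
move E : (\dim U - \dim X)%N => r.
have q1 : (1 < q)%N := finNzRing_gt1 F.
elim: r X E => [|r IH] X E XU.
  rewrite /geom big_ord0; apply/eqP; rewrite cards_eq0; apply/eqP/setP => H.
  rewrite !inE; apply/negP => /and3P[/dimvS XH _ /eqP dH].
  by have := dimvS XU; lia.
have dXU := dimvS XU.
have [r0|r_gt0] := posnP r.
  rewrite r0 /geom big_ord1; apply/eqP/cards1P; exists X; apply/setP => H.
  rewrite !inE; apply/and3P/eqP => [[XH _ /eqP dH]|->].
    by apply/eqP; rewrite eq_sym eqEdim XH /=; lia.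
  by split=> //; apply/eqP; lia.
(* Count the pairs (H, u) with u in U and outside H: the number of u is the same
   for every H, and for u outside X the number of H avoiding u is
   #|hyper X U| - geom q r by induction. *)
have pairs : (\sum_(H in hyper X U) #|[set u in U | u \notin H]|
            = \sum_(u in U) #|[set H in hyper X U | u \notin H]|)%N.
  transitivity (\sum_(H in hyper X U) \sum_(u in U) (u \notin H))%N.
    apply: eq_bigr => H _; rewrite -sum1_card big_mkcond [RHS]big_mkcond /=.
    by apply: eq_bigr => u _; rewrite inE; case: (u \in U); case: (u \in H).
  rewrite exchange_big; apply: eq_bigr => u _ /=.
  rewrite -sum1_card big_mkcond [RHS]big_mkcond /=; apply: eq_bigr => H _.
  by rewrite [in RHS]inE; case: (H \in hyper X U); case: (u \in H).
move: pairs.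
rewrite (eq_bigr (fun=> (q ^ \dim U - q ^ (\dim U).-1)%N)); last first.
  by move=> H; rewrite inE => /and3P[_ HU /eqP dH]; rewrite card_notin // -dH.
rewrite sum_nat_const.
rewrite (bigID (fun u => u \in X)) /= big1 ?add0n; last first.
  move=> u /andP[_ uX]; apply/eqP; rewrite cards_eq0; apply/eqP/setP => H.
  by rewrite !inE; apply/negP => /andP[/and3P[/subvP/(_ u uX) -> ]].
rewrite (eq_bigr (fun=> (#|hyper X U| - geom q r)%N)); last first.
  move=> u /andP[uU uX]; rewrite -(IH (X + <[u]>)%VS); last first.
  - by rewrite subv_add XU -memvE.
  - by rewrite dim_add_line //; lia.
  rewrite -hyper_line // -cardsDS; last by apply/subsetP => H; rewrite inE => /andP[].
  apply: eq_card => H; rewrite !inE.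
  by case: (X <= H)%VS; case: (H <= U)%VS; case: eqP; case: (u \in H).
rewrite sum_nat_const.
have -> : #|[pred u in U | u \notin X]| = (q ^ \dim U - q ^ \dim X)%N.
  by rewrite -card_notin //; apply: eq_card => u; rewrite !inE.
have -> : \dim U = (\dim X + r.+1)%N by lia.
have leg : (geom q r <= #|hyper X U|)%N.
  have /subvPn[u uU uX] : ~~ (U <= X)%VS by apply/negP => /dimvS; lia.
  rewrite -(IH (X + <[u]>)%VS).
  - by apply/subset_leq_card/subsetP => H; rewrite -hyper_line // inE => /andP[].
  - by rewrite dim_add_line //; lia.
  - by rewrite subv_add XU -memvE.
move/(congr1 (fun m => m%:R : rat)).
rewrite !natrM !natrB ?leq_pexp2l ?leq_addr ?(ltnW q1) //; last by lia.
rewrite addnS /= !natrX exprS !exprD.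
have := geom_rat r; have := geom_rat r.+1; rewrite exprS.
set c := #|hyper X U|%:R; set g := (geom q r)%:R; set g' := (geom q r.+1)%:R.
set Q := q%:R ^+ r; set Q' := q%:R ^+ \dim X => g'E gE cE.
have Q'0 : Q' != 0 by rewrite expf_neq0 // pnatr_eq0; lia.
have Q1 : Q - 1 != 0.
  by rewrite subr_eq0 /Q -natrX pnatr_eq1 -(expn0 q) eqn_exp2l //; lia.
have q10 : q%:R - 1 != 0 :> rat by rewrite subr_eq0 pnatr_eq1; lia.
suff : c = g' by move/eqP; rewrite eqr_nat => /eqP.
apply: (mulIf (mulf_neq0 (mulf_neq0 Q1 Q'0) q10)).
have cE' : c * (Q - 1) * Q' = (q%:R * Q - 1) * g * Q' by lra.
rewrite (_ : c * _ = c * (Q - 1) * Q' * (q%:R - 1)); last by ring.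
rewrite cE' [LHS](_ : _ = (q%:R * Q - 1) * Q' * (g * (q%:R - 1))); last by ring.
by rewrite gE -g'E; ring.
Qed.

Lemma card_hyper_avoid X Y U : (X <= Y)%VS -> (Y <= U)%VS ->
  #|[set H in hyper X U | ~~ (Y <= H)%VS]|
  = (geom q (\dim U - \dim X) - geom q (\dim U - \dim Y))%N.
Proof.
move=> XY YU; rewrite -!card_hyper ?(subv_trans XY) // -cardsDS; last first.
  by apply/subsetP => H; rewrite !inE => /andP[/(subv_trans XY) -> ].
apply: eq_card => H; rewrite !inE.
by case: (Y <= H)%VS; case: (X <= H)%VS; case: (H <= U)%VS; case: eqP.
Qed.

End Hyperplanes.

(** * Cumulative sums of matrix entries *)

Section Cumulative.
Variable n : nat.
Implicit Types (A : 'M[nat]_n).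

Definition cum A (i j : nat) : nat :=
  (\sum_(x : 'I_n * 'I_n | (x.1 < i) && (x.2 < j)) A x.1 x.2)%N.

(** Inclusion-exclusion on the rectangle with corner [x]. It makes the entries of
    a matrix recoverable from its cumulative sums. *)
Lemma cum_rec A (x : 'I_n * 'I_n) :
  (cum A x.1.+1 x.2.+1 + cum A x.1 x.2
   = cum A x.1 x.2.+1 + cum A x.1.+1 x.2 + A x.1 x.2)%N.
Proof.
have cumE i j : cum A i j = (\sum_(y : 'I_n * 'I_n) ((y.1 < i) && (y.2 < j)) * A y.1 y.2)%N.
  by rewrite /cum big_mkcond; apply: eq_bigr => y _; case: ifP; rewrite ?mul1n ?mul0n.
rewrite !cumE -!big_split /= (bigD1 x) //= [in RHS](bigD1 x) //=.
rewrite !ltnSn !ltnn /= mul1n !mul0n addn0 !add0n addnC; congr (_ + _)%N.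
apply: eq_bigr => y; rewrite -pair_eqE /pair_eq /= -!val_eqE /= => ne.
by move: (A y.1 y.2) => a; case: ltngtP ne => //; case: ltngtP => //=; lia.
Qed.

Lemma cum0l A j : cum A 0 j = 0%N. Proof. by rewrite /cum big_pred0. Qed.
Lemma cum0r A i : cum A i 0 = 0%N.
Proof. by rewrite /cum big_pred0 // => x; rewrite andbF. Qed.

Lemma cum_inj A B : (forall i j, cum A i j = cum B i j) -> A = B.
Proof.
move=> E; apply/matrixP => i j.
by have := cum_rec A (i, j); have := cum_rec B (i, j); rewrite !E /=; lia.
Qed.

Lemma cum_unique A (N : nat -> nat -> nat) :
  (forall j, N 0%N j = 0%N) -> (forall i, N i 0%N = 0%N) ->
  (forall x : 'I_n * 'I_n, N x.1.+1 x.2.+1 + N x.1 x.2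
     = N x.1 x.2.+1 + N x.1.+1 x.2 + A x.1 x.2)%N ->
  forall i j, (i <= n)%N -> (j <= n)%N -> N i j = cum A i j.
Proof.
move=> Nl Nr Nx; elim=> [|i IHi] j; first by rewrite Nl cum0l.
elim: j => [|j IHj] ltin ltjn; first by rewrite Nr cum0r.
have := Nx (Ordinal ltin, Ordinal ltjn); have := cum_rec A (Ordinal ltin, Ordinal ltjn).
move=> /=; rewrite IHj ?(IHi j.+1) ?(IHi j) //; lia.
Qed.

Lemma cum_minn A i j : cum A (minn i n) (minn j n) = cum A i j.
Proof.
apply: eq_bigl => x; have := ltn_ord x.1; have := ltn_ord x.2.
by rewrite !leq_min => -> ->; rewrite !andbT.
Qed.

Lemma cum_full A i j : (n <= i)%N -> (n <= j)%N -> cum A i j = (\sum_i \sum_j A i j)%N.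
Proof.
move=> ni nj; rewrite pair_bigA; apply: eq_bigl => x.
by rewrite (leq_trans (ltn_ord _) ni) (leq_trans (ltn_ord _) nj).
Qed.

Lemma count_cells A (R : pred ('I_n * 'I_n)) :
  count (fun c => R c.1) (cells A) = (\sum_(x | R x) A x.1 x.2)%N.
Proof.
rewrite /cells count_flatten -map_comp sumnE big_map big_enum big_mkcond /=.
rewrite [RHS]big_mkcond; apply: eq_bigr => x _ /=; rewrite count_map.
case: ifP => Rx.
  by rewrite (@eq_count _ _ predT) ?count_predT ?size_iota // => s /=; rewrite Rx.
by rewrite (@eq_count _ _ pred0) ?count_pred0 // => s /=; rewrite Rx.
Qed.

Lemma mem_cells A x s : ((x, s) \in cells A) = (1 <= s <= A x.1 x.2)%N.
Proof.
apply/allpairsPdep/idP => [[y [t [_ ti [-> ->]]]]|H].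
  by move: ti; rewrite mem_iota add1n ltnS.
by exists x, s; rewrite mem_enum mem_iota add1n ltnS.
Qed.

End Cumulative.

(** * Relative position of two flags and a vector *)

Section Position.
Variables (F : finFieldType) (n d : nat).
Implicit Types (f g : flag F n d) (A : 'M[nat]_n) (D : {set 'I_n * 'I_n}) (w : 'rV[F]_d).

(** Indexing by all natural numbers, constant from [n] on, avoids casts between
    ordinals and keeps the steps monotone. *)
Definition step f (i : nat) : {vspace 'rV[F]_d} := f (inord (minn i n)).

Lemma step_ord f (i : 'I_n.+1) : step f i = f i.
Proof. by rewrite /step (minn_idPl _) -1?ltnS // inord_val. Qed.

Lemma step0 f : step f 0 = 0%VS.
Proof.
have /and3P[/eqP f0 _ _] := flag_valP f.
by rewrite -f0 -step_ord.
Qed.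

Lemma step_full f i : (n <= i)%N -> step f i = fullv.
Proof.
have /and3P[_ /eqP fn _] := flag_valP f => ni.
by rewrite -fn -step_ord /step /= (minn_idPr ni) minnn.
Qed.

Lemma step_minn f i : step f (minn i n) = step f i.
Proof. by rewrite /step -minnA minnn. Qed.

Lemma step_mono f i j : (i <= j)%N -> (step f i <= step f j)%VS.
Proof.
have /and3P[_ _ /forallP fm] := flag_valP f => ij.
have /forallP/(_ (inord (minn j n))) := fm (inord (minn i n)).
by rewrite !inordK ?ltnS ?geq_minr // => /implyP; apply; lia.
Qed.

Lemma flag_eq f g : (forall i, (i <= n)%N -> step f i = step g i) -> f = g.
Proof.
move=> E; apply/val_inj/ffunP => i; rewrite -!step_ord; apply: E.
by rewrite -ltnS.
Qed.

Lemma flag_ofP (s : nat -> {vspace 'rV[F]_d}) : s 0%N = 0%VS -> s n = fullv ->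
  (forall i j, (i <= j <= n)%N -> (s i <= s j)%VS) ->
  exists f, forall i, (i <= n)%N -> step f i = s i.
Proof.
move=> s0 sn sm; have fP : is_flag [ffun i : 'I_n.+1 => s i].
  apply/and3P; split; rewrite ?ffunE ?s0 ?sn //.
  apply/forallP => i; apply/forallP => j; apply/implyP => ij; rewrite !ffunE.
  by apply: sm; rewrite ij -ltnS ltn_ord.
exists (Flag fP) => i ni.
by rewrite /step ffunE inordK (minn_idPl ni).
Qed.

(** The complete invariants of an orbit. The first condition determines [A], the
    second one the staircase of [D]; sums [V_i + V'_j] are used because a vector
    adapted to the cells lies in such a sum exactly when each of its cells is
    above row [i] or left of column [j]. *)
Definition position A D f f' w :=
  (forall i j, \dim (step f i :&: step f' j) = cum A i j) /\
  (forall i j, (w \in step f i + step f' j)%VS = (stair D i <= j)%N).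

Lemma position_uniq A D A' D' f f' w : antichain D -> antichain D' ->
  position A D f f' w -> position A' D' f f' w -> A = A' /\ D = D'.
Proof.
move=> aD aD' [dA sD] [dA' sD']; split.
  by apply: cum_inj => i j; rewrite -dA.
apply: stair_inj => // i; apply/eqP.
by rewrite eqn_leq -sD sD' leqnn -sD' sD leqnn.
Qed.

Lemma in_XiP A D : in_Xi d (A, D) <->
  [/\ (\sum_i \sum_j A i j = d)%N, antichain D & forall x, x \in D -> (0 < A x.1 x.2)%N].
Proof.
split=> [/and3P[/eqP dA sD /forall_inP posA]|[dA sD posA]].
  by split=> //; apply/dlist_antichain.
by apply/and3P; split; [apply/eqP | apply/dlist_antichain | apply/forall_inP].
Qed.

Section CellSpans.
Variables (A : 'M[nat]_n) (e : 'I_n * 'I_n * nat -> 'rV[F]_d).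
Hypothesis e_free : free [seq e c | c <- cells A].
Implicit Types P Q : pred ('I_n * 'I_n * nat).

(** For a basis indexed by the cells, spans of sets of cells form a Boolean
    lattice, so that dimensions and memberships reduce to counting cells. *)
Definition cspan P : {vspace 'rV[F]_d} := <<[seq e c | c <- cells A & P c]>>%VS.

Lemma dim_cspan P : \dim (cspan P) = count P (cells A).
Proof.
have pe : perm_eq ([seq e c | c <- cells A & P c] ++ [seq e c | c <- cells A & ~~ P c])
     [seq e c | c <- cells A].
  by rewrite -map_cat perm_map // perm_filterC.
move: e_free; rewrite -(perm_free pe) => /catl_free; rewrite /free => /eqP ->.
by rewrite size_map size_filter.
Qed.

Lemma cspanU P Q : (cspan P + cspan Q = cspan (predU P Q))%VS.
Proof.
rewrite /cspan -span_cat -map_cat; apply: eq_span => v; apply/mapP/mapP => -[c cA ->].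
  by exists c => //; move: cA; rewrite mem_cat !mem_filter /= -andb_orl.
by exists c => //; move: cA; rewrite mem_cat !mem_filter /= -andb_orl.
Qed.

Lemma dim_cspanI P Q : \dim (cspan P :&: cspan Q) = count (predI P Q) (cells A).
Proof.
have := dimv_sum_cap (cspan P) (cspan Q); rewrite cspanU !dim_cspan.
by have := count_predUI P Q (cells A); lia.
Qed.

Lemma mem_cspan P c : c \in cells A -> P c -> e c \in cspan P.
Proof. by move=> cA Pc; apply/memv_span/map_f; rewrite mem_filter Pc. Qed.

Lemma cspan_notin P c : c \in cells A -> ~~ P c -> e c \notin cspan P.
Proof.
move=> cA Pc; apply/negP => ecP.
have : e c \in (cspan (pred1 c) :&: cspan P)%VS by rewrite memv_cap mem_cspan //=.
have /eqP -> : (cspan (pred1 c) :&: cspan P == 0)%VS.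
  rewrite -dimv_eq0 dim_cspanI (@eq_count _ _ pred0) ?count_pred0 // => b /=.
  by apply/negP => /andP[/eqP->]; rewrite (negPf Pc).
rewrite memv0; apply/negP/(free_not0 e_free); exact: map_f.
Qed.

Lemma mem_sum_cspan D P : (forall x, x \in D -> (x, 1%N) \in cells A) ->
  (\sum_(x in D) e (x, 1%N) \in cspan P) <-> (forall x, x \in D -> P (x, 1%N)).
Proof.
move=> DA; split=> [wP x xD|H]; last by apply: memv_suml => x xD; apply: mem_cspan; auto.
apply: contraTT wP => Px; rewrite (bigD1 x) //=; apply/negP => wP.
suff : e (x, 1%N) \in cspan (fun c => c != (x, 1%N)).
  by apply/negP/cspan_notin; rewrite ?eqxx ?DA.
have sub : (cspan P <= cspan (fun c => c != (x, 1%N)))%VS.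
  apply: sub_span => _ /mapP[c + ->]; rewrite mem_filter => /andP[Pc cA].
  apply: map_f; rewrite mem_filter cA andbT; apply: contraTneq Pc => ->; exact: Px.
rewrite -(@rpredDr _ _ (\sum_(i in D | i != x) e (i, 1%N))); first exact: (subvP sub).
apply: memv_suml => y /andP[yD yx]; apply: mem_cspan; first exact: DA.
by apply: contra yx => /eqP[->].
Qed.

End CellSpans.

(** Both steps are spans of sets of cells: [V_i] takes the rows above [i] and
    [V'_j] the columns left of [j]. *)
Lemma in_orbit_position A D f f' w : (forall x, x \in D -> (0 < A x.1 x.2)%N) ->
  Defs.in_orbit A D f f' w -> position A D f f' w.
Proof.
move=> posA [e [eb fE f'E wE]].
have ef := basis_free eb.
have sE i : step f i = cspan A e (fun c => c.1.1 < i)%N.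
  rewrite /step fE /cspan; congr (<<map _ _>>)%VS; apply: eq_filter => c.
  by rewrite inordK ?ltnS ?geq_minr // leq_min ltn_ord andbT.
have s'E i : step f' i = cspan A e (fun c => c.1.2 < i)%N.
  rewrite /step f'E /cspan; congr (<<map _ _>>)%VS; apply: eq_filter => c.
  by rewrite inordK ?ltnS ?geq_minr // leq_min ltn_ord andbT.
split=> i j; rewrite sE s'E.
  by rewrite dim_cspanI // [RHS]/cum -(@count_cells _ A (fun x => (x.1 < i) && (x.2 < j))%N).
rewrite cspanU // wE; apply/idP/idP.
  rewrite mem_sum_cspan //=; last by move=> x xD; rewrite mem_cells posA.
  by move=> H; apply/stair_leP => x xD ix; move: (H x xD); rewrite ltnNge ix.
move/stair_leP => H; apply/mem_sum_cspan => //= x xD; first by rewrite mem_cells posA.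
by case: ltnP => //= ix; apply: H.
Qed.

End Position.

(** * Adapted bases *)

Section Orbits.
Variables (F : finFieldType) (n d : nat).
Implicit Types (f g : flag F n d) (A : 'M[nat]_n) (D : {set 'I_n * 'I_n}) (w : 'rV[F]_d).

(** The part of [V_i cap V'_j] already reached from the cells before [x]; a basis
    adapted to both flags needs [A x.1 x.2] further vectors at [x]. *)
Definition corner f f' (x : 'I_n * 'I_n) : {vspace 'rV[F]_d} :=
  (step f x.1 :&: step f' x.2.+1 + step f x.1.+1 :&: step f' x.2)%VS.

Lemma corner_sub f f' x : (corner f f' x <= step f x.1.+1 :&: step f' x.2.+1)%VS.
Proof. by rewrite subv_add !capvS ?step_mono. Qed.

(** The two summands of the corner intersect in [step f x.1 :&: step f' x.2]. *)
Lemma dim_corner f f' x :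
  (\dim (corner f f' x) + \dim (step f x.1 :&: step f' x.2) =
   \dim (step f x.1 :&: step f' x.2.+1) + \dim (step f x.1.+1 :&: step f' x.2))%N.
Proof.
rewrite -[RHS]dimv_sum_cap; congr addn; congr dimv; apply/vspaceP => v.
rewrite !memv_cap; apply/andP/idP => [[v1 v2]|/andP[/andP[v1 _] /andP[_ v2]]]; last by [].
by rewrite v1 v2 (subvP (step_mono f (leqnSn _)) _ v1) (subvP (step_mono f' (leqnSn _)) _ v2).
Qed.

Lemma extend_span (S T : {vspace 'rV[F]_d}) : (S <= T)%VS ->
  exists2 b : seq 'rV[F]_d, size b = (\dim T - \dim S)%N & (S + <<b>> = T)%VS.
Proof.
move=> ST; exists (vbasis (T :\: S)%VS).
  by rewrite size_tuple -(dimv_cap_compl T S) (capv_idPr ST) addKn.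
by rewrite (span_basis (vbasisP _)) addvC addv_diff; apply/addv_idPl.
Qed.

Lemma extend_span_with (S T : {vspace 'rV[F]_d}) u : (S <= T)%VS -> u \in T -> u \notin S ->
  exists b : seq 'rV[F]_d,
    [/\ size b = (\dim T - \dim S)%N, (S + <<b>> = T)%VS & nth 0 b 0 = u].
Proof.
move=> ST uT uS; have SuT : (S + <[u]> <= T)%VS by rewrite subv_add ST -memvE.
have [b bs bT] := extend_span SuT; exists (u :: b); split=> //=.
  by rewrite bs; have := dimvS SuT; rewrite dim_add_line //; lia.
by rewrite span_cons addvA.
Qed.

(** For each column bound [c] choose [Y c] in [V'_c] with [w - Y c] in the smallest
    possible step of [f]. Then [Y (J 0) = w] and [Y (J n) = 0] for the staircase
    [J], and the successive differences [Y (J i) - Y (J i.+1)] are the components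
    of [w] at the cells of [D]. Choosing [Y] as a function of [c], not of [i],
    makes the difference vanish in the rows without a cell. *)
Lemma split_vector D f f' w : antichain D ->
  (forall i j, (w \in step f i + step f' j)%VS = (stair D i <= j)%N) ->
  exists2 u : 'I_n * 'I_n -> 'rV[F]_d, w = \sum_(x in D) u x &
    forall x, x \in D -> u x \in (step f x.1.+1 :&: step f' x.2.+1)%VS
                      /\ u x \notin corner f f' x.
Proof.
move=> aD wJ.
have /choice[Y YP] : forall c : nat, exists y, y \in step f' c /\
    forall i, (stair D i <= c)%N -> w - y \in step f i.
  move=> c; have ex : exists i, (stair D i <= c)%N by exists n; rewrite stair_out.
  case: (ex_minnP ex) => i0; rewrite -wJ => /memv_addP[a ai0 [y yc ->]] i0min.
  exists y; split=> // i /i0min ii0; rewrite addrK.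
  exact: (subvP (step_mono f ii0)).
have YinC i : Y (stair D i) \in step f' (stair D i) by case: (YP (stair D i)).
have wY i : w - Y (stair D i) \in step f i by case: (YP (stair D i)) => _; apply.
exists (fun x : 'I_n * 'I_n => Y (stair D x.1) - Y (stair D x.1.+1)); last first.
  move=> x; rewrite antichain_mem // => /andP[J1 /eqP J0]; split.
    rewrite memv_cap; apply/andP; split.
      rewrite (_ : _ - _ = (w - Y (stair D x.1.+1)) - (w - Y (stair D x.1))); last first.
        by rewrite opprB [RHS]addrC addrA subrK.
      by rewrite rpredB // (subvP (step_mono f (leqnSn x.1))).
    rewrite rpredB // -?J0 // (subvP (step_mono f' _) _ (YinC _)) //.
    by rewrite stair_mono.
  apply/negP => uS; have : (w \in step f x.1 + step f' x.2)%VS; last by rewrite wJ J0 ltnn.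
  have uS' : Y (stair D x.1) - Y (stair D x.1.+1) \in (step f x.1 + step f' x.2)%VS.
    by apply: subvP uS; rewrite addvS ?capvSl ?capvSr.
  rewrite -(subrK (Y (stair D x.1)) w) rpredD //.
    by rewrite (subvP (addvSl _ _)).
  rewrite -[X in X \in _](subrK (Y (stair D x.1.+1))) rpredD //.
  apply: (subvP (addvSr _ _)); exact: (subvP (step_mono f' J1)).
have Y0 : Y (stair D 0) = w.
  by have := wY 0%N; rewrite step0 memv0 subr_eq0 => /eqP.
have Yn : Y (stair D n) = 0.
  by have := YinC n; rewrite stair_out // step0 memv0 => /eqP.
rewrite (partition_big fst predT) //=.
transitivity (Y (stair D 0) - Y (stair D n)); first by rewrite Y0 Yn subr0.
rewrite -[LHS]opprB.
rewrite -(telescope_sumr (fun i => Y (stair D i))) // big_mkord -sumrN.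
apply: eq_bigr => i _; rewrite opprB.
have memD j : ((i, j) \in D) = (stair D i.+1 <= j < stair D i)%N && (stair D i == j.+1).
  by rewrite antichain_mem //=; lia.
have := stair_mono D (leqnSn i); rewrite leq_eqVlt => /orP[/eqP E|lt].
  rewrite big_pred0 ?E ?subrr // => -[i' j] /=; apply/negP => /andP[+ /eqP E'].
  by rewrite E' memD E; lia.
have ltj : ((stair D i).-1 < n)%N by have := stair_le D i; lia.
rewrite (big_pred1 (i, Ordinal ltj)) // => -[i' j] /=.
rewrite xpair_eqE andbC; case: eqP => //= ->; rewrite memD -val_eqE /=; lia.
Qed.

(** At each cell complete the corner to [V_i cap V'_j] by [A x.1 x.2] vectors, the
    first of which is the component of [w] if the cell is decorated. By induction
    on the cells these vectors span all intersections of steps, and their number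
    is [d]. *)
Lemma position_in_orbit A D f f' w : in_Xi d (A, D) ->
  position A D f f' w -> Defs.in_orbit A D f f' w.
Proof.
move=> /in_XiP[dA aD posA] [cA wJ].
have [u wE uP] := split_vector aD wJ.
have dimA (x : 'I_n * 'I_n) :
    (\dim (step f x.1.+1 :&: step f' x.2.+1) - \dim (corner f f' x))%N = A x.1 x.2.
  by have := dim_corner f f' x; have := cum_rec A x; rewrite !cA; lia.
have /choice[b bP] : forall x : 'I_n * 'I_n, exists b : seq 'rV[F]_d,
    [/\ size b = A x.1 x.2, (corner f f' x + <<b>> = step f x.1.+1 :&: step f' x.2.+1)%VS
      & x \in D -> nth 0 b 0 = u x].
  move=> x; rewrite -dimA; have [xD|xD] := boolP (x \in D).
    have [uT uS] := uP x xD.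
    by have [b [? ? ?]] := extend_span_with (corner_sub f f' x) uT uS; exists b.
  by have [b ? ?] := extend_span (corner_sub f f' x); exists b.
pose e (c : 'I_n * 'I_n * nat) := nth 0 (b c.1) c.2.-1.
pose G i j : {vspace 'rV[F]_d} :=
  <<[seq e c | c : 'I_n * 'I_n * nat <- cells A & (c.1.1 < i)%N && (c.1.2 < j)%N]>>%VS.
have GS i j i' j' : (i <= i')%N -> (j <= j')%N -> (G i j <= G i' j')%VS.
  move=> ii jj; apply: sub_span => _ /mapP[c + ->]; rewrite mem_filter => /andP[ij cc].
  by apply: map_f; rewrite mem_filter cc; move: ij; lia.
have GE i j : (i <= n)%N -> (j <= n)%N -> G i j = (step f i :&: step f' j)%VS.
  move=> ni nj; apply/eqP; rewrite eqEsubv; apply/andP; split.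
    apply/span_subvP => _ /mapP[[x s] + ->]; rewrite mem_filter mem_cells /=.
    move=> /andP[/andP[xi xj] /andP[s1 sA]].
    have [bs bT _] := bP x.
    apply: (subvP (_ : (step f x.1.+1 :&: step f' x.2.+1 <= _)%VS)).
      by apply: capvS; apply: step_mono.
    rewrite -bT (subvP (addvSr _ _)) // memv_span // /e /= mem_nth // bs; lia.
  elim: i j ni nj => [|i IHi]; first by move=> j _ _; rewrite step0 cap0v sub0v.
  elim=> [|j IHj] lti ltj; first by rewrite step0 capv0 sub0v.
  pose x : 'I_n * 'I_n := (Ordinal lti, Ordinal ltj).
  have [bs bT _] := bP x.
  rewrite -[X in (X <= _)%VS]/(step f x.1.+1 :&: step f' x.2.+1)%VS -bT.
  rewrite !subv_add /= (subv_trans (IHi j.+1 _ _)) ?GS //; last exact: ltnW.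
  rewrite (subv_trans (IHj _ _)) ?GS //; last exact: ltnW.
  apply/span_subvP => v vb; apply: memv_span; apply/mapP.
  exists (x, (index v (b x)).+1); last by rewrite /e /= nth_index.
  by rewrite mem_filter /= !ltnSn mem_cells /= -[A _ _]/(A x.1 x.2) -bs index_mem vb.
have spanE (i j : nat) (P : pred ('I_n * 'I_n * nat)) :
    (forall c, P c = (c.1.1 < i)%N && (c.1.2 < j)%N) ->
    <<[seq e c | c <- cells A & P c]>>%VS = G i j.
  by move=> PE; rewrite /G; congr (<<map _ _>>)%VS; apply: eq_filter.
exists e; split.
- have sE : [seq e c | c <- cells A] = [seq e c | c <- cells A & predT c].
    by rewrite filter_predT.
  rewrite basisEdim; apply/andP; split.
    rewrite sE (spanE n n) ?GE // ?step_full ?capfv //.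
    by move=> c; rewrite !ltn_ord.
  rewrite size_map dimvf /dim /= mul1n -[X in (_ <= X)%N]dA.
  rewrite -(cum_full A (leqnn n) (leqnn n)) -(count_predT (cells A)).
  rewrite (@count_cells _ A predT) /cum leq_eqVlt; apply/orP; left; apply/eqP.
  by apply: eq_bigl => x; rewrite !ltn_ord.
- move=> i; rewrite (spanE i n) => [|c]; last by rewrite ltn_ord andbT.
  have ni : (i <= n)%N by rewrite -ltnS.
  by rewrite GE // step_ord step_full // capvf.
- move=> j; rewrite (spanE n j) => [|c]; last by rewrite ltn_ord.
  have nj : (j <= n)%N by rewrite -ltnS.
  by rewrite GE // step_ord step_full // capfv.
- rewrite wE; apply: eq_bigr => x xD; rewrite /e /=.
  by have [_ _ ->] := bP x.
Qed.

Lemma in_orbitP A D f f' w : in_Xi d (A, D) ->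
  Defs.in_orbit A D f f' w <-> position A D f f' w.
Proof.
move=> ADX; split; last exact: position_in_orbit.
by case/in_XiP: ADX => _ _ posA; apply: in_orbit_position.
Qed.

End Orbits.

Section Classification.
Variables (F : finFieldType) (n d : nat).
Implicit Types (f g : flag F n d) (A : 'M[nat]_n) (D : {set 'I_n * 'I_n}) (w : 'rV[F]_d).

(** The dimensions of the intersections of steps and the least [j] with [w] in
    [V_i + V'_j] are invariants of every triple, so every triple lies in an
    orbit. *)
Lemma position_exists f f' w : exists X : Xi n d, position (val X).1 (val X).2 f f' w.
Proof.
have exJ i : exists j, (w \in step f i + step f' j)%VS.
  by exists n; rewrite (step_full f' (leqnn n)) (subvP (addvSr _ _)) ?memvf.
pose J i := ex_minn (exJ i).
have JP i j : (w \in step f i + step f' j)%VS = (J i <= j)%N.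
  rewrite /J; case: ex_minnP => m wm mmin; apply/idP/idP; first exact: mmin.
  by move=> mj; apply: subvP wm; rewrite addvS ?step_mono.
have Jmono i j : (i <= j)%N -> (J j <= J i)%N.
  move=> ij; rewrite -JP; have : (J i <= J i)%N by []; rewrite -JP.
  by apply: subvP; rewrite addvS ?step_mono.
have Jn i : (n <= i)%N -> J i = 0%N.
  by move=> ni; apply/eqP; rewrite -leqn0 -JP (step_full f ni) (subvP (addvSl _ _)) ?memvf.
have J0 : (J 0%N <= n)%N by rewrite -JP (step_full f' (leqnn n)) (subvP (addvSr _ _)) ?memvf.
have [aD DJ] := stair_set Jmono Jn J0; set D := [set x | _] in aD DJ.
have wJ i j : (w \in step f i + step f' j)%VS = (stair D i <= j)%N by rewrite JP DJ.
pose A : 'M[nat]_n := \matrix_(i, j)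
  (\dim (step f i.+1 :&: step f' j.+1) - \dim (corner f f' (i, j)))%N.
have cA i j : \dim (step f i :&: step f' j) = cum A i j.
  rewrite -cum_minn -(step_minn f) -(step_minn f').
  apply: (@cum_unique _ _ (fun i j => \dim (step f i :&: step f' j))); rewrite ?geq_minr //.
  - by move=> l; rewrite step0 cap0v dimv0.
  - by move=> l; rewrite step0 capv0 dimv0.
  - move=> x; rewrite -dim_corner mxE -surjective_pairing.
    by have := dimvS (corner_sub f f' x); lia.
have ADX : in_Xi d (A, D).
  apply/in_XiP; split=> //.
    by rewrite -(cum_full A (leqnn n) (leqnn n)) -cA !step_full // capvf dimvf /dim /= mul1n.
  move=> x xD; have [u _ /(_ x xD)[uT uS]] := split_vector aD wJ.
  rewrite mxE -surjective_pairing subn_gt0.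
  have /ltn_leqif -> := dimv_leqif_sup (corner_sub f f' x).
  by apply: contra uS => /subvP; apply.
by exists (XiOf ADX).
Qed.

Lemma position_inhabited A D : in_Xi d (A, D) ->
  exists f f' w, position A D f f' w.
Proof.
move=> ADX; have /in_XiP[dA aD posA] := ADX.
(* index an arbitrary basis by the cells *)
pose b := vbasis (fullv : {vspace 'rV[F]_d}).
have ucells : uniq (cells A).
  rewrite /cells allpairs_uniq_dep ?enum_uniq //; first by move=> x _; apply: iota_uniq.
  by move=> [x s] [y t] _ _ /= [-> ->].
have scells : size (cells A) = d.
  rewrite -(count_predT (cells A)) (@count_cells _ A predT) -dA.
  by rewrite -(cum_full A (leqnn n) (leqnn n)); apply: eq_bigl => x; rewrite !ltn_ord.
pose e c := nth 0 b (index c (cells A)).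
have eb : [seq e c | c <- cells A] = b.
  apply: (@eq_from_nth _ 0).
    by rewrite size_map scells size_tuple dimvf /dim /= mul1n.
  move=> i; rewrite size_map => li; have x0 : 'I_n * 'I_n * nat by case: (cells A) li.
  by rewrite (nth_map x0) // /e index_uniq.
have ebasis : basis_of fullv [seq e c | c <- cells A] by rewrite eb vbasisP.
have mono (P Q : pred ('I_n * 'I_n * nat)) :
    (forall c, P c -> Q c) -> (cspan A e P <= cspan A e Q)%VS.
  move=> PQ; apply: sub_span => _ /mapP[c + ->]; rewrite mem_filter => /andP[Pc cA].
  by apply: map_f; rewrite mem_filter PQ.
have full (P : pred ('I_n * 'I_n * nat)) : (forall c, P c) -> cspan A e P = fullv.
  move=> Pall; rewrite -(span_basis ebasis) /cspan; congr (<<map _ _>>)%VS.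
  by rewrite -[RHS]filter_predT; apply: eq_filter => c; rewrite Pall.
have zero (P : pred ('I_n * 'I_n * nat)) : (forall c, ~~ P c) -> cspan A e P = 0%VS.
  move=> Pno; rewrite /cspan (@eq_filter _ _ pred0) ?filter_pred0 ?span_nil // => c.
  by apply/negbTE.
have [f fE] : exists f : flag F n d, forall i, (i <= n)%N ->
    step f i = cspan A e (fun c => (c.1.1 < i)%N).
  apply: flag_ofP => [||i j /andP[ij _]]; [exact: zero | by apply: full => c | ].
  by apply: mono => c /leq_trans; apply.
have [f' f'E] : exists f : flag F n d, forall i, (i <= n)%N ->
    step f i = cspan A e (fun c => (c.1.2 < i)%N).
  apply: flag_ofP => [||i j /andP[ij _]]; [exact: zero | by apply: full => c | ].
  by apply: mono => c /leq_trans; apply.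
exists f, f', (\sum_(x in D) e (x, 1%N)).
apply: in_orbit_position => //; have le_n (i : 'I_n.+1) : (i <= n)%N by rewrite -ltnS.
by exists e; split=> // i; rewrite -step_ord ?fE ?f'E.
Qed.

Lemma chiE (Z : Xi n d) f f' w :
  chi Z f f' w = (`[< position (val Z).1 (val Z).2 f f' w >])%:R.
Proof.
rewrite /chi; congr (nat_of_bool _)%:R; apply: asbool_equiv_eq; apply: in_orbitP.
by rewrite -surjective_pairing; case: Z.
Qed.

Lemma Xi_antichain (Z : Xi n d) : antichain (val Z).2.
Proof. by case: Z => -[A D] /= /in_XiP[]. Qed.

Lemma chi_pos (Z Z' : Xi n d) f f' w : position (val Z).1 (val Z).2 f f' w ->
  chi Z' f f' w = (Z' == Z)%:R.
Proof.
move=> pZ; rewrite chiE; congr (nat_of_bool _)%:R; apply/asboolP/eqP => [pZ'|-> //].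
have [EA ED] := position_uniq (@Xi_antichain Z') (@Xi_antichain Z) pZ' pZ.
by apply: val_inj; rewrite [LHS]surjective_pairing EA ED -surjective_pairing.
Qed.

Lemma sum_chi (c : Xi n d -> algC) (Z : Xi n d) f f' w :
  position (val Z).1 (val Z).2 f f' w -> \sum_Z' c Z' * chi Z' f f' w = c Z.
Proof.
move=> pZ; rewrite (bigD1 Z) //= (chi_pos Z pZ) eqxx mulr1 big1 ?addr0 // => Z' ne.
by rewrite (chi_pos Z' pZ) (negPf ne) mulr0.
Qed.

End Classification.

(** * Uniqueness of the structure constants *)

Section GenericProduct.
Variables n d : nat.
Implicit Types X Y : Xi n d.

(** Every orbit is nonempty over every finite field, so two families of structure
    constants agree at the square root of every prime. *)
Lemma generic_product_uniq X Y (c c' : MS n d) :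
  generic_product X Y c -> generic_product X Y c' -> c = c'.
Proof.
move=> cP c'P; apply/ffunP => Z; apply: laurent_eq => p pp.
have ZP : in_Xi d ((val Z).1, (val Z).2) by rewrite -surjective_pairing; case: Z.
have [f [f' [w pZ]]] := @position_inhabited 'F_p n d _ _ ZP.
have := cP 'F_p f f' w; rewrite (c'P 'F_p f f' w) !(sum_chi _ pZ).
by rewrite card_Fp.
Qed.

Lemma basis_mulE X Y c : generic_product X Y c -> basis_mul X Y = c.
Proof.
move=> cP; rewrite /basis_mul; case: classical_sets.xgetP => [c' _ /= c'P|/(_ c)]; last by [].
exact: generic_product_uniq c'P cP.
Qed.

Lemma ms_mul_ebasis X Y : ms_mul (ebasis d (val X).1 (val X).2) (ebasis d (val Y).1 (val Y).2)
   = basis_mul X Y.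
Proof.
have eE (Z Z' : Xi n d) : ebasis d (val Z).1 (val Z).2 Z' = (Z' == Z)%:R.
  by rewrite ffunE -surjective_pairing (inj_eq val_inj).
rewrite /ms_mul (bigD1 X) //= (bigD1 Y) //= !eE !eqxx mulr1 scale1r.
rewrite big1 ?addr0; last by move=> Y' ne; rewrite !eE (negPf ne) mulr0 scale0r.
rewrite big1 ?addr0 // => X' ne; apply: big1 => Y' _.
by rewrite !eE (negPf ne) mul0r scale0r.
Qed.

End GenericProduct.

Definition coef_at n d (s : algC) (Z : Xi n d) (c : MS n d) : algC := leval s (c Z).

Section MoreCumulative.
Variable n : nat.
Implicit Types (A B : 'M[nat]_n).

Definition tail A (h : 'I_n) (j : nat) : nat := (\sum_(b < n | (j <= b)%N) A h b)%N.

Lemma tail_rec A (h p : 'I_n) : (tail A h p = A h p + tail A h p.+1)%N.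
Proof.
rewrite /tail (bigD1 p) //=; congr (_ + _)%N; apply: eq_bigl => j.
by rewrite -val_eqE /=; lia.
Qed.

(** The right-hand side splits row [h] at column [j]. *)
Lemma cum_row A (h : 'I_n) j :
  (cum A h.+1 n + cum A h j = cum A h n + cum A h.+1 j + tail A h j)%N.
Proof.
have cumE i l : (cum A i l = \sum_(a < n | a < i) \sum_(b < n | b < l) A a b)%N.
  by rewrite pair_big_dep.
have rowE l : (cum A h.+1 l = cum A h l + \sum_(b < n | (b < l)%N) A h b)%N.
  rewrite !cumE (bigD1 h) //= addnC; congr (_ + _)%N; apply: eq_bigl => a.
  by rewrite -val_eqE /=; lia.
rewrite !rowE /tail.
have -> : (\sum_(b < n | (b < n)%N) A h b = \sum_b A h b)%N.
  by apply: eq_bigl => b; rewrite ltn_ord.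
rewrite (bigID (fun b : 'I_n => (b < j)%N)) /=.
by under [X in (_ + (_ + X) + _)%N]eq_bigl => b do rewrite -leqNgt; lia.
Qed.

(** Moving one unit of column [p] from row [h1] up to row [h] is seen only by the
    rectangles that end between these rows and contain column [p]. *)
Lemma cum_shift A (h h1 : 'I_n) p i j : h1 = h.+1 :> nat -> (1 <= A h1 p)%N ->
  cum (shift_mx A h h1 p) i j = (cum A i j + ((i == h1 :> nat) && (p < j)))%N.
Proof.
move=> h1E Ap; have ltp := ltn_ord p; have lth1 := ltn_ord h1.
have -> : (i == h1) && (p < j)%N = (minn i n == h1) && (p < minn j n)%N by lia.
rewrite -cum_minn -(cum_minn A).
symmetry; apply: (@cum_unique _ _ (fun i j => cum A i j + ((i == h1) && (p < j)))%N);
  rewrite ?geq_minr //.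
- by move=> l; rewrite cum0l h1E.
- by move=> l; rewrite cum0r andbF.
move=> x; have := cum_rec A x; have : ((x.1 == h1) && (x.2 == p) <= A x.1 x.2)%N.
  by case: eqP => // ->; case: eqP => // ->.
rewrite mxE -!val_eqE /= h1E eqSS.
case: (ltngtP x.1 h.+1) => c1; case: (ltngtP x.1 h) => c2; case: (ltngtP p x.2) => c3;
    rewrite ?ltnS; case: (leqP p x.2) => c4 /=; lia.
Qed.

Lemma shift_of_cum A A' (h h1 : 'I_n) (p : 'I_n) : h1 = h.+1 :> nat ->
  (forall i j, cum A' i j = cum A i j + ((i == h1 :> nat) && (p < j)))%N ->
  (1 <= A h1 p)%N /\ A' = shift_mx A h h1 p.
Proof.
move=> h1E H; have E x : (A' x.1 x.2 + ((x.1 == h1) && (x.2 == p))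
                     = A x.1 x.2 + ((x.1 == h) && (x.2 == p)))%N.
  have := cum_rec A x; have := cum_rec A' x; rewrite !H -!val_eqE /= h1E eqSS.
  case: (ltngtP x.1 h.+1) => c1; case: (ltngtP x.1 h) => c2; case: (ltngtP p x.2) => c3;
    rewrite ?ltnS; case: (leqP p x.2) => c4 /=; lia.
split; first by have := E (h1, p); rewrite /= !eqxx -!val_eqE /= h1E; lia.
by apply/matrixP => i j; rewrite mxE; have := E (i, j) => /= <-; rewrite addnK.
Qed.

End MoreCumulative.

(** If row [h] holds a cell of [D] strictly to the right of column [p], then the
    entry at that cell is positive. This is what makes the exponents with a [- 1]
    in the multiplication formulas nonnegative. *)
Lemma tail_pos (n : nat) (h : 'I_n) (A : 'M[nat]_n) (D : {set 'I_n * 'I_n}) p :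
  (forall x, x \in D -> (0 < A x.1 x.2)%N) ->
  (stair D h.+1 < stair D h)%N -> (p.+1 < stair D h)%N -> (0 < tail A h p.+1)%N.
Proof.
move=> posA lt pc; have [|x [xD hx xE]] := @stair_attained _ D h; first by lia.
have E : x.1 = h.
  apply: val_inj => /=; apply/eqP; rewrite eqn_leq hx andbT leqNgt; apply/negP => hx'.
  by have := stair_ltn xD hx'; lia.
have := posA x xD; rewrite E /tail (bigD1 x.2) /=; lia.
Qed.

(** * Multiplication by an elementary matrix *)

Section Elementary.
Variable n : nat.
Variables (h h1 : 'I_n) (h1E : h1 = h.+1 :> nat) (B : 'M[nat]_n).
Hypothesis Bdiag : is_diag_mx (map_mx Posz B - delta_mx h h1 : 'M[int]_n).

Lemma elementary_entry a b : a != b -> B a b = (a == h) && (b == h1) :> nat.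
Proof.
move=> ab; have /is_diag_mxP/(_ a b ab) := Bdiag; rewrite !mxE.
by case: (_ && _) => /=; lia.
Qed.

Lemma elementary_cum_le i j : (j <= i)%N -> cum B i j = cum B n j.
Proof.
move=> ji; rewrite /cum [RHS](bigID (fun x : 'I_n * 'I_n => (x.1 < i)%N)) /=.
rewrite [X in (_ + X)%N]big1 ?addn0; last first.
  move=> x /andP[/andP[_ xj] xi]; have ne : x.1 != x.2 by rewrite -val_eqE /=; lia.
  by rewrite elementary_entry // -!val_eqE /= h1E; lia.
by apply: eq_bigl => x; rewrite ltn_ord andbC.
Qed.

Lemma elementary_cum_gt i j : (i < j)%N -> cum B i j = cum B i n.
Proof.
move=> ij; rewrite /cum [RHS](bigID (fun x : 'I_n * 'I_n => (x.2 < j)%N)) /=.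
rewrite [X in (_ + X)%N]big1 ?addn0; last first.
  move=> x /andP[/andP[xi _] xj]; have ne : x.1 != x.2 by rewrite -val_eqE /=; lia.
  by rewrite elementary_entry // -!val_eqE /= h1E; lia.
by apply: eq_bigl => x; rewrite ltn_ord andbT.
Qed.

Lemma elementary_cum_row i : cum B i n = (cum B i i + (i == h1 :> nat))%N.
Proof.
have ltn1 := ltn_ord h1.
rewrite /cum [LHS](bigID (fun x : 'I_n * 'I_n => (x.2 < i)%N)) /=; congr (_ + _)%N.
  by apply: eq_bigl => x; rewrite ltn_ord andbT.
rewrite (eq_bigr (fun x => ((x == (h, h1)) : nat))); last first.
  move=> x /andP[/andP[xi _] xj]; have ne : x.1 != x.2 by rewrite -val_eqE /=; lia.
  by rewrite elementary_entry // -pair_eqE.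
rewrite -big_mkcondr /= sum1_card; case: eqP => [->|ne] /=.
  rewrite (@eq_card1 _ (h, h1)) // => x; rewrite unfold_in /= inE.
  by case: eqP => [->|_]; rewrite ?andbF //= ltn_ord h1E; lia.
apply: eq_card0 => x; rewrite unfold_in /=; apply/negP => /andP[/andP[/andP[xi _] xj] /eqP E].
by move: xi xj; rewrite E /=; lia.
Qed.

Variables (F : finFieldType) (d : nat).
Implicit Types (f g : flag F n d) (A : 'M[nat]_n) (D : {set 'I_n * 'I_n}) (w : 'rV[F]_d).

(** [g] is obtained from [f] by replacing the step [h1] with a hyperplane of it.
    The hyperplane contains the step before, because the steps of [g] increase. *)
Definition lowers f g :=
  [/\ forall i, (i <= n)%N -> i <> h1 -> step g i = step f i,
      (step g h1 <= step f h1)%VS & (\dim (step g h1)).+1 = \dim (step f h1)].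

Lemma lowers_sub f g i : lowers f g -> (step g i <= step f i)%VS.
Proof.
case=> E sub _; rewrite -step_minn -(step_minn f).
by have [->//|ne] := eqVneq (minn i n) h1; rewrite E ?geq_minr //; apply/eqP.
Qed.

Lemma lowers_dim f g i : (i <= n)%N -> lowers f g ->
  \dim (step f i) = (\dim (step g i) + (i == h1 :> nat))%N.
Proof.
move=> ni [E _ dE]; case: eqP => [->|ne]; first by rewrite -dE addn1.
by rewrite E ?addn0.
Qed.

Lemma stair_set0 i : stair (set0 : {set 'I_n * 'I_n}) i = 0%N.
Proof. by apply/eqP; rewrite -leqn0; apply/stair_leP => x; rewrite inE. Qed.

(** The sums of [B] say that [f] and [g] have the same dimensions except at the
    step [h1], where they differ by one, and that [step g i] lies in [step f i]. *)
Lemma position_elementary f g w : position B set0 f g w <->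
  [/\ w = 0, lowers f g & forall i, (i <= n)%N -> \dim (step f i) = cum B i n].
Proof.
split=> [[dB wB]|[-> fg df]].
  have df i : \dim (step f i) = cum B i n by rewrite -dB (step_full g (leqnn n)) capvf.
  have dg i : \dim (step g i) = cum B n i by rewrite -dB (step_full f (leqnn n)) capfv.
  have sub i : (step g i <= step f i)%VS.
    apply/capv_idPr/eqP; rewrite eqEdim capvSr dB dg.
    by rewrite (elementary_cum_le (leqnn _)) leqnn.
  split=> //.
    by apply/eqP; have := wB 0%N 0%N; rewrite stair_set0 !step0 addv0 memv0.
  split=> // [i ni ne|]; last first.
    by rewrite df dg elementary_cum_row eqxx addn1 (elementary_cum_le (leqnn _)).
  apply/eqP; rewrite eqEdim sub df dg elementary_cum_row.
  by case: eqP => // _; rewrite addn0 (elementary_cum_le (leqnn _)) leqnn.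
split=> i j; last first.
  by rewrite stair_set0 leq0n mem0v.
rewrite -cum_minn -step_minn -(step_minn g).
have := geq_minr i n; have := geq_minr j n.
move: (minn i n) (minn j n) => {}i {}j nj ni.
have dg l : (l <= n)%N -> \dim (step g l) = cum B n l.
  move=> nl; apply/eqP; rewrite -(eqn_add2r (l == h1 :> nat)) -(lowers_dim nl fg).
  by rewrite df // elementary_cum_row (elementary_cum_le (leqnn _)).
have [ji|ij] := leqP j i.
  rewrite (elementary_cum_le ji) -dg //; congr dimv; apply/capv_idPr.
  exact: subv_trans (lowers_sub _ fg) (step_mono f ji).
rewrite elementary_cum_gt // -df //; congr dimv; apply/capv_idPl.
have [E _ _] := fg; have [jk|jk] := eqVneq j h1.
  rewrite -E; [exact: (step_mono g (ltnW ij)) | by [] | by lia].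
by rewrite (E j) //; [exact: (step_mono f (ltnW ij)) | apply/eqP].
Qed.

Lemma convolution_elementary (X Y : Xi n d) f f' w : val X = (B, set0) ->
  convolution (@chi F n d X) (@chi F n d Y) f f' w =
  #|[set g | `[< [/\ lowers f g, forall i, (i <= n)%N -> \dim (step f i) = cum B i n
              & position (val Y).1 (val Y).2 g f' w] >]]|%:R.
Proof.
move=> XE; rewrite /convolution -sum1_card natr_sum [RHS]big_mkcond.
apply: eq_bigr => g _; rewrite inE (bigD1 0) //= subr0 !chiE XE /= -natrM mulnb.
rewrite big1 ?addr0; last first.
  move=> mu mu0; rewrite !chiE XE /=.
  case: asboolP => [/position_elementary[E]|_]; last by rewrite mul0r.
  by rewrite E eqxx in mu0.
case: (asboolP [/\ _, _ & _]) => [[fg df pY]|H].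
  by rewrite !asboolT //; apply/position_elementary.
suff /negbTE -> :
    ~~ (`[< position B set0 f g 0 >] && `[< position (val Y).1 (val Y).2 g f' w >]) by [].
apply/negP => /andP[/asboolP/position_elementary[_ fg df] /asboolP pY].
by apply: H.
Qed.

End Elementary.

(** * Lowering one step of a flag *)

Section Neighbours.
Variables (F : finFieldType) (n d : nat).
Variables (h h1 : 'I_n) (h1E : h1 = h.+1 :> nat).
Implicit Types (f g : flag F n d) (A : 'M[nat]_n) (D : {set 'I_n * 'I_n}) (w : 'rV[F]_d).
Implicit Types (U W H : {vspace 'rV[F]_d}).

Lemma dim_hyperplane_cap U W H : (H <= U)%VS -> (\dim H).+1 = \dim U -> (W <= U)%VS ->
  \dim W = (\dim (H :&: W) + ~~ (W <= H)%VS)%N.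
Proof.
move=> HU dH WU; have [WH|WH] := boolP (W <= H)%VS; first by rewrite (capv_idPr WH) addn0.
have HWU : (H + W <= U)%VS by rewrite subv_add HU.
have dHW : (\dim H < \dim (H + W))%N.
  have /ltn_leqif -> := dimv_leqif_sup (addvSl H W).
  by rewrite subv_add subvv.
by have := dimv_sum_cap H W; have := dimvS HWU; lia.
Qed.

Lemma dim_lowers f g f' i j : lowers h1 f g ->
  \dim (step f i :&: step f' j) = (\dim (step g i :&: step f' j)
    + ((i == h1 :> nat) && ~~ (step f h1 :&: step f' j <= step g h1)%VS))%N.
Proof.
move=> fg; have [E sub dim1] := fg; have [->|ne] /= := eqVneq i h1.
  rewrite (dim_hyperplane_cap sub dim1 (capvSl _ (step f' j))) capvA.
  by rewrite (capv_idPl sub).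
rewrite addn0; congr (\dim (_ :&: _)).
rewrite -step_minn -[RHS]step_minn E ?geq_minr //.
by have := ltn_ord h1; move/eqP: ne; lia.
Qed.

(** Let [p.+1] be the first [j] for which the hyperplane [step g h1] does not
    contain [step f h1 :&: step f' j]. The intersections with the steps of [f']
    drop by one dimension from there on, and only in the step [h1]. *)
Lemma lowers_shift A D A' D' f g f' w : lowers h1 f g ->
  position A D g f' w -> position A' D' f f' w ->
  exists p, (1 <= A h1 p)%N /\ A' = shift_mx A h h1 p.
Proof.
move=> fg [dA _] [dA' _]; have [E sub dim1] := fg.
have ex : exists j, ~~ (step f h1 :&: step f' j <= step g h1)%VS.
  exists n; rewrite (step_full f' (leqnn n)) capvf; apply/negP => /dimvS.
  by rewrite -dim1 ltnn.
case: (ex_minnP ex) => -[|p]; first by rewrite step0 capv0 sub0v.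
move=> Hp pmin; have ltp : (p < n)%N.
  rewrite ltnNge; apply/negP => le; have := pmin p.
  rewrite (step_full f' le) -(step_full f' (leqW le)) => /(_ Hp); lia.
exists (Ordinal ltp); apply: shift_of_cum => // i j.
rewrite -dA' -dA (dim_lowers f' i j fg) /=; congr (_ + (_ && _))%N.
apply/idP/idP; first exact: pmin.
move=> pj; apply: contra Hp; apply: subv_trans.
by apply: capvS => //; apply: step_mono.
Qed.

Variables (A : 'M[nat]_n) (p : 'I_n) (Ap : (1 <= A h1 p)%N).
Variables (D D' : {set 'I_n * 'I_n}) (f f' : flag F n d) (w : 'rV[F]_d).
Hypothesis pos' : position (shift_mx A h h1 p) D' f f' w.

Let U := step f h1.
Let c0 := stair D' h1.

(** The intersection of [U] with [step f' j] loses a dimension when [U] is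
    replaced by a hyperplane exactly when the hyperplane does not contain it. *)
Lemma jump_dims g : lowers h1 f g ->
  (forall i j, \dim (step g i :&: step f' j) = cum A i j) <->
  (U :&: step f' p <= step g h1)%VS && ~~ (U :&: step f' p.+1 <= step g h1)%VS.
Proof.
move=> fg; case: pos' => dA' _.
(* both sides are the dimension of step f i :&: step f' j *)
have key i j : (\dim (step g i :&: step f' j)
    + ((i == h1 :> nat) && ~~ (U :&: step f' j <= step g h1)%VS)
    = cum A i j + ((i == h1 :> nat) && (p < j)))%N.
  by rewrite -(dim_lowers f' i j fg) dA' cum_shift.
split=> [dA|/andP[Up Up1] i j].
  have keyj j : (U :&: step f' j <= step g h1)%VS = (j <= p)%N.
    by have := key h1 j; rewrite dA eqxx /=; case: (_ <= _)%VS; case: leqP => //=; lia.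
  by rewrite !keyj leqnn ltnn.
suff E : (U :&: step f' j <= step g h1)%VS = (j <= p)%N.
  by have := key i j; rewrite E -ltnNge; lia.
have [jp|pj] := leqP j p.
  by apply: subv_trans Up; apply: capvS => //; apply: step_mono.
by apply/negbTE; apply: contra Up1; apply: subv_trans; apply: capvS => //; apply: step_mono.
Qed.

Variables (u y : 'rV[F]_d) (wE : w = u + y) (uU : u \in U) (yc0 : y \in step f' c0).

(** Since [y] already lies in [step f' c0], only [u] matters for [j >= c0]. Up to
    column [p] the hyperplane absorbs [U :&: step f' j], so [u] has to lie in it;
    after column [p] the sum contains [U]. *)
Lemma jump_stair g : lowers h1 f g ->
  (U :&: step f' p <= step g h1)%VS -> ~~ (U :&: step f' p.+1 <= step g h1)%VS ->
  forall j, (w \in step g h1 + step f' j)%VS =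
    ((if (p < c0)%N || (u \in step g h1) then c0 else p.+1) <= j)%N.
Proof.
move=> fg Up Up1 j; have [E sub dim1] := fg; case: pos' => _ wJ.
have [c0j|jc0] := leqP c0 j; last first.
  transitivity false.
    apply/negbTE; apply: contraL jc0 => wH; rewrite -leqNgt -wJ.
    by apply: subvP wH; rewrite addvS.
  case: ifP => [_|/negbT]; first by rewrite leqNgt jc0.
  by rewrite negb_or -leqNgt => /andP[c0p _]; lia.
have yj : y \in (step g h1 + step f' j)%VS.
  by apply: (subvP (addvSr _ _)); apply: (subvP (step_mono f' c0j)).
rewrite wE rpredDr //.
have [jp|pj] := leqP j p; last first.
  have -> : ((if (p < c0)%N || (u \in step g h1) then c0 else p.+1) <= j)%N by case: ifP.
  suff : (U <= step g h1 + step f' j)%VS by move/subvP; apply.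
  have UE : (step g h1 + U :&: step f' p.+1 == U)%VS.
    rewrite eqEdim subv_add sub capvSl /= -dim1.
    have /ltn_leqif -> := dimv_leqif_sup (addvSl (step g h1) (U :&: step f' p.+1)%VS).
    by rewrite subv_add subvv.
  rewrite -(eqP UE) addvS //; apply: subv_trans (capvSr _ _) _; exact: step_mono.
rewrite ltnNge (leq_trans c0j jp) /=.
have -> : (u \in step g h1 + step f' j)%VS = (u \in step g h1).
  apply/idP/idP; last exact: subvP (addvSl _ _) _.
  move=> uH; have : u \in (U :&: (step g h1 + step f' j))%VS by rewrite memv_cap uU.
  rewrite [(U :&: _)%VS]capvC -vspace_modl // [(_ :&: U)%VS]capvC (addv_idPl _) //.
  by apply: subv_trans Up; apply: capvS => //; apply: step_mono.
by case: ifP; rewrite ?c0j // => _; apply/esym/negbTE; rewrite -leqNgt.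
Qed.

Lemma jump_position g : lowers h1 f g ->
  position A D g f' w <->
  [/\ forall i : nat, i <> h1 -> stair D i = stair D' i,
      (U :&: step f' p <= step g h1)%VS && ~~ (U :&: step f' p.+1 <= step g h1)%VS
    & stair D h1 = if (p < c0)%N || (u \in step g h1) then c0 else p.+1].
Proof.
move=> fg; have [E sub dim1] := fg; case: (pos') => _ wJ.
have eqS a b : (forall j, (a <= j) = (b <= j))%N -> a = b.
  by move=> H; apply/eqP; rewrite eqn_leq H leqnn -H leqnn.
split=> [[dA wD]|[sD UH sD1]].
  have UH := (jump_dims fg).1 dA; split=> //.
    move=> i ne; have [ni|ni] := leqP i n; last by rewrite !stair_out // ltnW.
    by apply: eqS => j; rewrite -wD -wJ E.
  by case/andP: UH => Up Up1; apply: eqS => j; rewrite -wD (jump_stair fg Up Up1).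
split; first exact/(jump_dims fg).
move=> i j; case/andP: UH => Up Up1.
have [->|ne] := eqVneq i h1; first by rewrite sD1 (jump_stair fg Up Up1).
have [ni|ni] := leqP i n; first by rewrite 1?E // 1?sD //; apply/eqP.
by rewrite (stair_out _ (ltnW ni)) (step_full g (ltnW ni)) (subvP (addvSl _ _)) ?memvf.
Qed.

End Neighbours.

(** Number of hyperplanes of [step f h1] above [step f h] that contain its
    intersection with [step f' p] but not with [step f' p.+1]. *)
Definition jump_total (q n : nat) (A : 'M[nat]_n) (h p : 'I_n) : nat :=
  (geom q (tail A h p).+1 - geom q (tail A h p.+1))%N.

(** The same number for hyperplanes that also contain [u], when [w = u + y] as in
    [jump_stair], [c] is the staircase of [w] at [h], and the staircase at [h1] is at
    most [p]. *)
Definition jump_through (q n : nat) (A : 'M[nat]_n) (h p : 'I_n) (c : nat) : nat :=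
  (geom q ((tail A h p).+1 - (p < c)) - geom q (tail A h p.+1 - (p.+1 < c)))%N.

Definition jump_count (q n : nat) (h h1 : 'I_n) (A : 'M[nat]_n) (p : 'I_n)
    (D D' : {set 'I_n * 'I_n}) : nat :=
  (if agree_off h1 D D' then
    if (p < stair D' h1)%N then if stair D h1 == stair D' h1 then jump_total q A h p else 0
    else if stair D h1 == stair D' h1 then jump_through q A h p (stair D' h)
    else if stair D h1 == p.+1 then
      jump_total q A h p - jump_through q A h p (stair D' h)
    else 0
  else 0)%N.

Section Counting.
Variables (F : finFieldType) (n d : nat).
Variables (h h1 : 'I_n) (h1E : h1 = h.+1 :> nat).
Implicit Types (f g : flag F n d).

(** A lowered flag is determined by its step [h1]. *)
Lemma card_lowers f (Q : pred {vspace 'rV[F]_d}) :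
  #|[set g | `[< lowers h1 f g >] && Q (step g h1)]|
  = #|[set H in hyper (step f h) (step f h1) | Q H]|.
Proof.
have ltn1 := ltn_ord h1.
rewrite -(@card_in_imset _ _ (fun g => step g h1)).
  apply: eq_card => H; apply/imsetP/idP => [[g + ->]|].
    rewrite !inE => /andP[/asboolP[E sub dim1] ->]; rewrite andbT.
    apply/and3P; split=> //; last by rewrite dim1.
    by rewrite -E ?step_mono ?h1E //; lia.
  rewrite !inE => /andP[/and3P[fhH HU /eqP dH] QH].
  have [|||g gE] := @flag_ofP F n d (fun i => if i == h1 :> nat then H else step f i).
  - by rewrite h1E /= step0.
  - by rewrite gtn_eqF // step_full.
  - move=> i j /andP[ij jn]; case: eqP => [iE|ine]; case: eqP => [jE|jne] //.
    + by apply: subv_trans HU _; apply: step_mono; lia.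
    + by apply: subv_trans fhH; apply: step_mono; lia.
    + exact: step_mono.
  have gh1 : step g h1 = H by rewrite gE ?eqxx // ltnW.
  exists g => //; rewrite inE gh1 QH andbT; apply/asboolP; split; rewrite ?gh1 //.
  by move=> i ni ne; rewrite gE //; case: eqP.
move=> g g'; rewrite !inE => /andP[/asboolP[E _ _] _] /andP[/asboolP[E' _ _] _] gg'.
apply: flag_eq => i ni; have [->//|/eqP ne] := eqVneq (i : nat) (h1 : nat).
by rewrite E // E'.
Qed.

Variables (A : 'M[nat]_n) (p : 'I_n) (Ap : (1 <= A h1 p)%N).
Variables (D D' : {set 'I_n * 'I_n}) (f f' : flag F n d) (w : 'rV[F]_d).
Hypothesis pos' : position (shift_mx A h h1 p) D' f f' w.

Let U := step f h1.
Let X j := (step f h + U :&: step f' j)%VS.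
Let c0 := stair D' h1.
Let c := stair D' h.

Lemma fhU : (step f h <= U)%VS. Proof. by apply: step_mono; lia. Qed.

Lemma dim_layer j : \dim U = (\dim (X j) + tail A h j + (j <= p))%N.
Proof.
case: pos' => dA _; have ltp := ltn_ord p.
have := dimv_sum_cap (step f h) (U :&: step f' j)%VS.
rewrite capvA (capv_idPl fhU) -/(X j) !dA !cum_shift // eqxx.
have <- : \dim (step f h :&: step f' n) = \dim (step f h).
  by rewrite (step_full f' (leqnn n)) capvf.
have <- : \dim (U :&: step f' n) = \dim U by rewrite (step_full f' (leqnn n)) capvf.
rewrite !dA !cum_shift // eqxx h1E ltp.
have -> : (h == h.+1 :> nat) = false by lia.
have := cum_row A h j; rewrite ltnNge; lia.
Qed.

Lemma layer_mono i j : (i <= j)%N -> (X i <= X j)%VS.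
Proof. by move=> ij; rewrite addvS // capvS // step_mono. Qed.

Lemma layer_sub j : (X j <= U)%VS.
Proof. by rewrite subv_add fhU capvSl. Qed.

Lemma card_jump :
  #|[set H in hyper (step f h) U |
     (U :&: step f' p <= H)%VS && ~~ (U :&: step f' p.+1 <= H)%VS]|
  = jump_total #|F| A h p.
Proof.
transitivity #|[set H in hyper (X p) U | ~~ (X p.+1 <= H)%VS]|.
  apply: eq_card => H; rewrite !inE !subv_add.
  by case: (step f h <= H)%VS; case: (H <= U)%VS; case: eqP; case: (_ <= H)%VS.
rewrite card_hyper_avoid ?layer_mono ?layer_sub //.
have := dim_layer p; have := dim_layer p.+1; rewrite leqnn ltnn.
by move=> E1 E2; congr (geom _ _ - geom _ _)%N; lia.
Qed.

Variables (u y : 'rV[F]_d) (wE : w = u + y) (uU : u \in U) (yc0 : y \in step f' c0).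

(** By the modular law [u] lies in [X j] exactly when it lies in
    [step f h + step f' j]; and there [u] and [w] differ by [y]. *)
Lemma mem_layer j : (c0 <= j)%N -> (u \in X j) = (c <= j)%N.
Proof.
case: pos' => _ wJ c0j; rewrite /c -wJ wE.
have yj : y \in (step f h + step f' j)%VS.
  by apply: (subvP (addvSr _ _)); apply: (subvP (step_mono f' c0j)).
rewrite rpredDr // /X [(U :&: _)%VS]capvC vspace_modl ?fhU // memv_cap uU andbT //.
Qed.

Lemma dim_layer_line j : (c0 <= j)%N -> \dim (X j + <[u]>) = (\dim (X j) + (j < c))%N.
Proof.
move=> c0j; have := mem_layer c0j; case: leqP => [cj uX|jc uX].
  by rewrite (addv_idPl _) ?addn0 // -memvE.
by rewrite dim_add_line ?addn1 ?uX.
Qed.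

Lemma card_jump_through : (c0 <= p)%N ->
  #|[set H in hyper (step f h) U | [&& (U :&: step f' p <= H)%VS,
       ~~ (U :&: step f' p.+1 <= H)%VS & u \in H]]|
  = jump_through #|F| A h p c.
Proof.
move=> c0p; transitivity #|[set H in hyper (X p + <[u]>) U | ~~ (X p.+1 + <[u]> <= H)%VS]|.
  apply: eq_card => H; rewrite !inE !subv_add -!memvE.
  case: (step f h <= H)%VS; case: (H <= U)%VS; case: eqP; case: (u \in H);
    by rewrite ?andbF ?andbT //=; case: (_ <= H)%VS.
rewrite card_hyper_avoid; last by rewrite subv_add layer_sub -memvE.
  rewrite !dim_layer_line ?(leqW c0p) //.
  have := dim_layer p; have := dim_layer p.+1; rewrite leqnn ltnn.
  by move=> E1 E2; congr (geom _ _ - geom _ _)%N; lia.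
by rewrite addvS // layer_mono.
Qed.

Lemma card_lowering :
  #|[set g | `[< lowers h1 f g /\ position A D g f' w >]]|
  = jump_count #|F| h h1 A p D D'.
Proof.
rewrite /jump_count -/c0 -/c; set good := agree_off h1 D D'.
pose Q (H : {vspace 'rV[F]_d}) := [&& good,
  (U :&: step f' p <= H)%VS && ~~ (U :&: step f' p.+1 <= H)%VS
  & stair D h1 == if (p < c0)%N || (u \in H) then c0 else p.+1].
transitivity #|[set g | `[< lowers h1 f g >] && Q (step g h1)]|.
  apply: eq_card => g; rewrite !inE /Q; apply/asboolP/idP.
    move=> [fg /(jump_position h1E Ap D pos' wE uU yc0 fg)[sD UH sD1]].
    by rewrite asboolT //= UH /= sD1 eqxx andbT; apply/agree_offP.
  case/andP=> /asboolP fg /and3P[/agree_offP sD UH /eqP sD1]; split=> //.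
  exact/(jump_position h1E Ap D pos' wE uU yc0 fg).
rewrite card_lowers /Q -/U; case: good {Q}; last first.
  by apply: eq_card0 => H; rewrite !inE andbF.
case: (ltnP p c0) => [pc0|c0p] /=.
  rewrite -card_jump; case: eqP => _.
    by apply: eq_card => H; rewrite !inE andbT.
  by apply: eq_card0 => H; rewrite !inE !andbF.
case: eqP => [sD|ne0].
  rewrite -card_jump_through //; apply: eq_card => H; rewrite !inE sD.
  have ne : (c0 == p.+1) = false by lia.
  by case: (u \in H); rewrite ?eqxx ?ne ?andbT ?andbF.
case: eqP => [sD|ne1]; last first.
  apply: eq_card0 => H; rewrite !inE.
  by case: (u \in H); rewrite ?(introF eqP ne0) ?(introF eqP ne1) ?andbF.
rewrite -card_jump -card_jump_through // -cardsDS; last first.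
  by apply/subsetP => H; rewrite !inE => /andP[-> /and3P[-> ->]].
apply: eq_card => H; rewrite !inE sD.
have -> : (p.+1 == (if u \in H then c0 else p.+1)) = (u \notin H).
  by case: (u \in H); rewrite ?eqxx //=; lia.
by case: (u \in H); rewrite /= ?andbT ?andbF ?andNb.
Qed.

End Counting.

(** * Reduction of the product to a count *)

Section Product.
Variables (n d : nat) (h h1 : 'I_n) (h1E : h1 = h.+1 :> nat).
Variables (A B : 'M[nat]_n).
Hypothesis roA_coB : ro A = co B.
Hypothesis Bdiag : is_diag_mx (map_mx Posz B - delta_mx h h1 : 'M[int]_n).

Lemma cum_ro_co i : cum A i n = cum B n i.
Proof.
have /rowP roco := roA_coB.
have -> : (cum A i n = \sum_(a < n | (a < i)%N) ro A 0%R a)%N.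
  under [RHS]eq_bigr => a _ do rewrite mxE.
  by rewrite pair_big_dep /=; apply: eq_bigl => x; rewrite ltn_ord andbT.
under eq_bigr => a _ do rewrite roco mxE.
rewrite pair_big_dep (reindex_inj (h := fun x => (x.2, x.1))) /=; last first.
  by move=> [? ?] [? ?] [-> ->].
by apply: eq_bigl => x; rewrite andbT ltn_ord.
Qed.

(** It suffices to compare, orbit by orbit, the value of a candidate at the square
    root of [q] with the number of flags that [card_lowering] counts. Orbits whose
    matrix is no [shift_mx A h h1 p] are not reached, by [lowers_shift]. *)
Lemma product_eq (X Y : Xi n d) (D : {set 'I_n * 'I_n}) (c : MS n d) :
  val X = (B, set0) -> val Y = (A, D) ->
  (forall s Z, s != 0 ->
     (forall p, (1 <= A h1 p)%N -> (val Z).1 <> shift_mx A h h1 p) -> coef_at s Z c = 0) ->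
  (forall q Z p, (1 < q)%N -> (1 <= A h1 p)%N -> (val Z).1 = shift_mx A h h1 p ->
     coef_at (sqrtC q%:R) Z c = (jump_count q h h1 A p D (val Z).2)%:R) ->
  ms_mul (ebasis d B set0) (ebasis d A D) = c.
Proof.
move=> XE YE Hno Hp; have := ms_mul_ebasis X Y; rewrite XE YE /= => ->.
apply: basis_mulE => F f f' w; have [Z pZ] := position_exists f f' w.
rewrite (sum_chi (fun Z => leval (sqrtC #|F|%:R) (c Z)) pZ) -/(coef_at _ Z c).
rewrite (convolution_elementary h1E Bdiag) // YE /=.
have q_gt1 := finNzRing_gt1 F.
have [[p [Ap E]]|no] := pselect (exists p, (1 <= A h1 p)%N /\ (val Z).1 = shift_mx A h h1 p);
  last first.
  rewrite Hno ?sqrtC_nat_neq0 //; last by move=> p Ap E; apply: no; exists p.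
  rewrite eq_card0 // => g; rewrite inE; apply/asboolP => -[fg _ pg]; apply: no.
  by have := lowers_shift h1E fg pg pZ.
rewrite (Hp _ Z p) //; congr (_%:R).
have dimf i : (i <= n)%N -> \dim (step f i) = cum B i n.
  have [dA _] := pZ => ni; rewrite -[step f i]capvf -(step_full f' (leqnn n)) dA E.
  rewrite cum_shift // ltn_ord andbT cum_ro_co (elementary_cum_row h1E Bdiag).
  by rewrite (elementary_cum_le h1E Bdiag (leqnn i)).
rewrite E in pZ; have [_ wJ] := pZ.
have := leqnn (stair (val Z).2 h1); rewrite -wJ => /memv_addP[u uU [y yc0 wE]].
rewrite -(card_lowering h1E Ap D pZ wE uU yc0); apply: eq_card => g.
by rewrite !inE; apply/asboolP/asboolP => [[? _ ?]|[? ?]].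
Qed.

End Product.

(** * The decorations that occur *)

Section Lowered.
Variable n : nat.
Variables (h h1 : 'I_n) (h1E : h1 = h.+1 :> nat).
Variable D : {set 'I_n * 'I_n}.
Hypothesis aD : antichain D.
Implicit Types E : {set 'I_n * 'I_n}.

(** If the staircases of [D] and [D'] agree at [h1] as well, then [D' = D].
    Otherwise a nonzero count requires hyperplanes that miss [u]; then the staircase
    of [D] at [h1] is [p.+1] and that of [D'] is smaller. *)
Lemma jump_countE q (A : 'M[nat]_n) (p : 'I_n) (D' : {set 'I_n * 'I_n}) : antichain D' ->
  jump_count q h h1 A p D D' =
  ((D' == D) *
     (if p < stair D h1 then jump_total q A h p else jump_through q A h p (stair D h))
  + [&& stair D h1 == p.+1, agree_off h1 D D' & stair D' h1 <= p] *
     (jump_total q A h p - jump_through q A h p (stair D h)))%N.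
Proof.
move=> aD'; rewrite -(@agree_off_eq _ h1) // /jump_count.
case: (boolP (agree_off h1 D D')) => [/(agree_off_next h1E)[_ E]|_] /=; last by rewrite !andbF.
rewrite E; case: (eqVneq (stair D h1) (stair D' h1)) => [->|ne] /=.
  by case: ltnP => c0p; rewrite ?andbF ?mul1n ?addn0 //; case: eqP; lia.
by case: leqP => c0p; case: eqP => //=; rewrite ?mul1n.
Qed.

(** Without a cell of [D] in row [h1] the staircase is constant there, so no lower
    value is possible at [h1]. *)
Lemma no_split p (D' : {set 'I_n * 'I_n}) : stair D h1 = stair D h1.+1 ->
  [&& stair D h1 == p.+1, agree_off h1 D D' & (stair D' h1 <= p)%N] = false.
Proof.
move=> E; apply/negP => /and3P[/eqP Ep /(agree_off_next h1E)[le _] c0p].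
by move: le; rewrite -E Ep; lia.
Qed.

Variables (p jh : 'I_n).
Hypothesis Jh1 : stair D h1 = p.+1.
Hypothesis Jh2 : (stair D h1.+1 <= p)%N.
Hypothesis Jh : stair D h = jh.+1.

(** The antichain of the smallest staircase that agrees with that of [D] off [h1]:
    the descent of row [h1] at [p] disappears and row [h] descends from [jh.+1]. When
    [D] has a cell in row [h] this cell is [(h, jh)] itself; otherwise [jh = p]. *)
Definition lowered := (D :\ (h1, p)) :|: [set (h, jh)].

(** A value at [h1] above that of the next row creates a cell in row [h1], in the
    column just before this value. *)
Lemma lowered_mem (D' : {set 'I_n * 'I_n}) x :
  antichain D' -> agree_off h1 D D' -> (stair D' h1 <= p)%N ->
  (x \in D') = (x \in lowered) ||
    [&& x.1 == h1, x.2.+1 == stair D' h1 & stair D h1.+1 < stair D' h1]%N.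
Proof.
move=> aD' /agree_offP E c0p; rewrite !inE !antichain_mem //.
have pjh : (p <= jh)%N by have := stair_mono D (leqnSn h); rewrite -h1E Jh Jh1.
case: x => a b; rewrite !xpair_eqE /= -!val_eqE /=.
have [ah1|nah1] := eqVneq (a : nat) (h1 : nat).
  have En : stair D' h1.+1 = stair D h1.+1 by rewrite E //; lia.
  by rewrite ah1 En Jh1 h1E; lia.
have [ah|nah] := eqVneq (a : nat) (h : nat).
  by rewrite ah -h1E Jh1 -(E h) ?Jh; lia.
by rewrite !(E a) ?(E a.+1) /=; lia.
Qed.

Lemma lowered_exists v : (stair D h1.+1 <= v <= p)%N ->
  exists D', [/\ antichain D', agree_off h1 D D' & stair D' h1 = v].
Proof.
move=> /andP[v1 v2]; pose J i := if i == h1 :> nat then v else stair D i.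
have J1 i j : (i <= j)%N -> (J j <= J i)%N.
  rewrite /J => ij; case: eqP => [je|jne]; case: eqP => [ie|ine] //.
  - by apply: leq_trans v2 _; apply: ltnW; rewrite -Jh1 stair_mono // -je.
  - by apply: leq_trans v1; rewrite stair_mono //; lia.
  - exact: stair_mono.
have ltn1 := ltn_ord h1.
have J2 i : (n <= i)%N -> J i = 0%N by move=> ni; rewrite /J gtn_eqF ?stair_out //; lia.
have J3 : (J 0%N <= n)%N by rewrite /J; case: eqP => [|_]; [lia | exact: stair_le].
have [aS SJ] := stair_set J1 J2 J3.
exists [set x : 'I_n * 'I_n | (J x.1.+1 <= x.2)%N && (J x.1 == x.2.+1)]; split=> //.
  by apply/agree_offP => i ne; rewrite SJ /J; case: eqP.
by rewrite SJ /J eqxx.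
Qed.

Lemma lowered_stair :
  [/\ antichain lowered, agree_off h1 D lowered & stair lowered h1 = stair D h1.+1].
Proof.
have [|D' [aD' ao s1]] := @lowered_exists (stair D h1.+1); first by rewrite leqnn.
suff -> : lowered = D' by [].
by apply/setP => x; rewrite (lowered_mem x aD' ao) s1 // ltnn !andbF orbF.
Qed.

Lemma lowered_add_stair (t : 'I_n) : (stair D h1.+1 < t.+1 <= p)%N ->
  let E := lowered :|: [set (h1, t)] in
  [/\ antichain E, agree_off h1 D E & stair E h1 = t.+1].
Proof.
move=> /andP[t1 t2] E; have [|D' [aD' ao s1]] := @lowered_exists t.+1; first by rewrite t2 ltnW.
suff -> : E = D' by [].
apply/setP => x; rewrite (lowered_mem x aD' ao) s1 // t1 andbT !in_setU; congr (_ || _).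
by rewrite inE -pair_eqE /= eqSS.
Qed.

(** The decorations of the last sums in the multiplication formulas are
    distinguished by their staircase at [h1], which takes each value between
    [stair D h1.+1] and [p] once. *)
Lemma lowered_sum (D' : {set 'I_n * 'I_n}) : antichain D' ->
  (agree_off h1 D D' && (stair D' h1 <= p)%N)%:R =
  (D' == lowered)%:R + \sum_(t < n | (stair D h1.+1 < t.+1 < p.+1)%N)
    (D' == lowered :|: [set (h1, t)])%:R :> algC.
Proof.
move=> aD'; have [aL aoL sL] := lowered_stair.
have [/andP[ao c0p]|nao] := boolP (_ && _); last first.
  rewrite (_ : D' == lowered = false) ?add0r; last first.
    by apply: contraNF nao => /eqP ->; rewrite aoL sL.
  rewrite big1 // => t tr; have /= [_ aoE sE] := lowered_add_stair tr.
  rewrite (_ : D' == _ = false) //; apply: contraNF nao => /eqP->.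
  by rewrite aoE sE; case/andP: tr.
have [le _] := agree_off_next h1E ao; have aoD := agree_offP _ _ _ ao.
have D'E E : antichain E -> agree_off h1 D E -> (D' == E) = (stair D' h1 == stair E h1).
  move=> aE aoE; apply/eqP/eqP => [->//|eqE]; apply: stair_inj => // i.
  by have [->//|/eqP ne] := eqVneq i h1; rewrite -aoD // (agree_offP _ _ _ aoE).
rewrite D'E // sL.
have sumE : \sum_(t < n | (stair D h1.+1 < t.+1 < p.+1)%N)
    (D' == lowered :|: [set (h1, t)])%:R =
    \sum_(t < n | (stair D h1.+1 < t.+1 < p.+1)%N) (stair D' h1 == t.+1)%:R :> algC.
  by apply: eq_bigr => t /lowered_add_stair /= [aE aoE sE]; rewrite D'E // sE.
rewrite sumE; have [eq|ne] := eqVneq (stair D' h1) (stair D h1.+1).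
  by rewrite eq big1 ?addr0 // => t /andP[lt _]; rewrite ltn_eqF.
rewrite add0r; have ltt : ((stair D' h1).-1 < n)%N by have := ltn_ord p; lia.
have tE : (Ordinal ltt).+1 = stair D' h1 by rewrite /=; move/eqP: ne; lia.
have lt2 : (stair D h1.+1 < (Ordinal ltt).+1 < p.+1)%N.
  by rewrite tE; move/eqP: ne; lia.
rewrite (bigD1 (Ordinal ltt) lt2) tE eqxx big1 /= ?addr0 // => t /andP[_ nt].
by rewrite -tE eqSS eq_sym (inj_eq val_inj) (negPf nt).
Qed.

End Lowered.

(** * Comparison of the coefficients *)

Section Values.
Variable q : nat.
Hypothesis q_gt1 : (1 < q)%N.
Local Notation s := (sqrtC q%:R : algC).

Lemma leval_vpow2 (N : nat) : leval s (vpow (2 * N%:Z)) = (q ^ N)%:R.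
Proof.
rewrite leval_vpow ?sqrtC_nat_neq0 // -exprz_exp -[2]/(Posz 2) -!exprnP sqrtCK.
by rewrite natrX.
Qed.

Lemma leval_vpow2B (N : nat) : (0 < N)%N -> leval s (vpow (2 * (N%:Z - 1))) = (q ^ N.-1)%:R.
Proof.
case: N => // N _; rewrite -leval_vpow2; congr (leval _ (vpow (_ * _))); lia.
Qed.

Lemma leval_qnum_geom m : leval s (qnum m) = (geom q m)%:R.
Proof.
rewrite leval_qnum ?sqrtC_nat_neq0 // sqrtCK /geom natr_sum.
by apply: eq_bigr => i _; rewrite natrX.
Qed.

Variables (n : nat) (h : 'I_n) (A : 'M[nat]_n) (p : 'I_n).
Let a := A h p.
Let N := tail A h p.+1.

Lemma jump_totalE : jump_total q A h p = (q ^ N * geom q a.+1)%N.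
Proof. by rewrite /jump_total tail_rec addnC -addnS geomD addKn. Qed.

Lemma jump_through_ge c : (c <= p)%N -> jump_through q A h p c = jump_total q A h p.
Proof. by move=> cp; rewrite /jump_through !ltnNge cp (leqW cp) !subn0. Qed.

Lemma jump_through_eq : jump_through q A h p p.+1 = (q ^ N * geom q a)%N.
Proof. by rewrite /jump_through ltnS leqnn ltnn subn1 subn0 tail_rec addnC geomD addKn. Qed.

Lemma jump_through_lt c : (0 < N)%N -> (p.+1 < c)%N ->
  jump_through q A h p c = (q ^ N.-1 * geom q a.+1)%N.
Proof.
move=> N0 pc; rewrite /jump_through pc (ltnW pc) !subn1 tail_rec -/a -/N /=.
by rewrite (_ : (a + N = N.-1 + a.+1)%N) ?geomD ?addKn //; lia.
Qed.

Lemma jump_missing_eq : (jump_total q A h p - jump_through q A h p p.+1 = q ^ tail A h p)%N.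
Proof.
rewrite jump_totalE jump_through_eq -mulnBr -[a.+1]addn1 geomD addKn /geom big_ord1 muln1.
by rewrite -expnD addnC -tail_rec.
Qed.

(** [q ^ N - q ^ (N - 1) = (q - 1) q ^ (N - 1)], and [q - 1] cancels the denominator
    of the geometric sum. *)
Lemma jump_missing_lt c : (0 < N)%N -> (p.+1 < c)%N ->
  (jump_total q A h p - jump_through q A h p c = q ^ tail A h p - q ^ N.-1)%N.
Proof.
move=> N0 pc; rewrite jump_totalE jump_through_lt // -mulnBl.
rewrite tail_rec -/a -/N; case: N N0 => // M _ /=; rewrite addnS -addSn addnC.
have -> : (q ^ (M + a.+1) = q ^ M * (q.-1 * geom q a.+1 + 1))%N.
  by rewrite expnD -predn_exp; congr (_ * _)%N; have := expn_gt0 q a.+1; lia.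
by rewrite mulnDr muln1 addnK expnS -{1}(prednK (ltnW q_gt1)) mulSn addKn mulnAC mulnC.
Qed.

Lemma leval_jump_total : leval s (vpow (2 * N%:Z) * qnum a.+1) = (jump_total q A h p)%:R.
Proof.
by rewrite levalM ?sqrtC_nat_neq0 // leval_vpow2 leval_qnum_geom -natrM jump_totalE.
Qed.

Lemma leval_jump_eq :
  leval s (vpow (2 * N%:Z) * qnum a) = (jump_through q A h p p.+1)%:R.
Proof.
by rewrite levalM ?sqrtC_nat_neq0 // leval_vpow2 leval_qnum_geom -natrM jump_through_eq.
Qed.

Lemma leval_jump_lt c : (0 < N)%N -> (p.+1 < c)%N ->
  leval s (vpow (2 * (N%:Z - 1)) * qnum a.+1) = (jump_through q A h p c)%:R.
Proof.
move=> N0 pc; rewrite levalM ?sqrtC_nat_neq0 // leval_vpow2B // leval_qnum_geom -natrM.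
by rewrite jump_through_lt.
Qed.

Lemma leval_missing_eq : leval s (vpow (2 * (tail A h p)%:Z)) =
  (jump_total q A h p - jump_through q A h p p.+1)%:R.
Proof. by rewrite leval_vpow2 jump_missing_eq. Qed.

Lemma leval_missing_lt c : (0 < N)%N -> (p.+1 < c)%N ->
  leval s (vpow (2 * (tail A h p)%:Z) - vpow (2 * (N%:Z - 1))) =
  (jump_total q A h p - jump_through q A h p c)%:R.
Proof.
move=> N0 pc; rewrite levalB ?sqrtC_nat_neq0 // leval_vpow2 leval_vpow2B //.
rewrite jump_missing_lt // natrB // leq_pexp2l ?(ltnW q_gt1) // tail_rec -/N; lia.
Qed.

(** With [J1] and [J0] the staircase at [h1] and [h]: up to column [J1] all
    hyperplanes count, since the staircase does not change there. Later the
    hyperplane has to contain [u], which is one more linear condition before column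
    [J0], excludes at [J0] those that miss the line of [u] modulo the layer before,
    and holds automatically after [J0]. *)
Lemma leval_row_values J1 J0 (x : algC) :
  (J1 < J0)%N -> ((p.+1 < J0)%N -> (0 < N)%N) ->
  ((p.+1 <= J1)%N || (J0 < p.+1)%N)%:R * (leval s (vpow (2 * N%:Z) * qnum a.+1) * x)
  + (J1 < p.+1 < J0)%N%:R * (leval s (vpow (2 * (N%:Z - 1)) * qnum a.+1) * x)
  + (p.+1 == J0)%:R * (leval s (vpow (2 * N%:Z) * qnum a) * x)
  = (if (p < J1)%N then jump_total q A h p else jump_through q A h p J0)%:R * x.
Proof.
move=> J10 N0; rewrite leval_jump_total leval_jump_eq.
case: (ltnP p J1) => pJ1.
  have -> : (p.+1 == J0) = false by apply/eqP; lia.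
  have -> : (J1 < p.+1 < J0)%N = false by lia.
  by rewrite /= mul1r !mul0r !addr0.
have -> : (J1 < p.+1)%N by [].
case: (ltngtP p.+1 J0) => [pJ0|J0p|<-] /=.
- by rewrite (@leval_jump_lt J0) ?N0 // mul1r !mul0r add0r addr0.
- by rewrite (@jump_through_ge J0) // mul1r !mul0r !addr0.
- by rewrite mul1r !mul0r !add0r.
Qed.

Lemma leval_row_values_split J1 J0 (x : algC) :
  (J1 < J0)%N -> ((p.+1 < J0)%N -> (0 < N)%N) ->
  (p.+1 <= J1)%N%:R * (leval s (vpow (2 * N%:Z) * qnum a.+1) * x)
  + (J1 < p.+1 < J0)%N%:R * (leval s (vpow (2 * (N%:Z - 1)) * qnum a.+1) * x)
  + (p.+1 == J0)%:R * (leval s (vpow (2 * N%:Z) * qnum a) * x)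
  + (J0 < p.+1)%N%:R * (leval s (vpow (2 * N%:Z) * qnum a.+1) * x)
  = (if (p < J1)%N then jump_total q A h p else jump_through q A h p J0)%:R * x.
Proof.
move=> J10 N0; rewrite -(leval_row_values x J10 N0).
have -> : ((p.+1 <= J1)%N || (J0 < p.+1)%N)%:R
    = (p.+1 <= J1)%N%:R + (J0 < p.+1)%N%:R :> algC.
  by rewrite -natrD; congr (_%:R); lia.
by move: (leval _ _) (leval _ _) (leval _ _) => l1 l2 l3; ring.
Qed.

End Values.

Section Coefficients.
Variables (n d : nat) (h h1 : 'I_n) (h1E : h1 = h.+1 :> nat) (A : 'M[nat]_n).
Variables (s : algC) (s0 : s != 0) (Z : Xi n d).
Implicit Types (P : pred 'I_n) (x : 'I_n -> laurent).

Lemma shift_inj (p p' : 'I_n) : shift_mx A h h1 p = shift_mx A h h1 p' -> p = p'.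
Proof.
have ne : (h == h1) = false by rewrite -val_eqE /=; lia.
move/matrixP/(_ h p); rewrite !mxE !eqxx ne /= !subn0.
by case: (eqVneq p p') => // _; lia.
Qed.

Lemma coef_atD (b c : MS n d) : coef_at s Z (b + c) = coef_at s Z b + coef_at s Z c.
Proof. by rewrite /coef_at ffunE levalD. Qed.

Lemma coef_at_sum I (r : seq I) (P : pred I) (G : I -> MS n d) :
  coef_at s Z (\sum_(i <- r | P i) G i) = \sum_(i <- r | P i) coef_at s Z (G i).
Proof.
apply: (big_morph (coef_at s Z)); first exact: coef_atD.
by rewrite /coef_at ffunE leval0.
Qed.

Lemma coef_at_ebasis a M E :
  coef_at s Z (a *: ebasis d M E) = leval s a * (val Z == (M, E))%:R.
Proof. by rewrite /coef_at !ffunE levalM // leval_bool. Qed.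

Lemma coef_at_row P x (E : 'I_n -> {set 'I_n * 'I_n}) p :
  (val Z).1 = shift_mx A h h1 p ->
  coef_at s Z (\sum_(p < n | P p) x p *: ebasis d (shift_mx A h h1 p) (E p))
  = (P p)%:R * (leval s (x p) * ((val Z).2 == E p)%:R).
Proof.
move=> ZE; rewrite coef_at_sum big_mkcond (bigD1 p) //= big1 ?addr0.
  rewrite coef_at_ebasis [val Z]surjective_pairing xpair_eqE ZE eqxx.
  by case: (P p); rewrite ?mul1r ?mul0r.
move=> p' ne; case: (P p') => //; rewrite coef_at_ebasis [val Z]surjective_pairing xpair_eqE.
have -> : ((val Z).1 == shift_mx A h h1 p') = false.
  by apply: contra_neqF ne; rewrite ZE => /eqP/shift_inj.
by rewrite mulr0.
Qed.

Lemma coef_at_row_none P x (E : 'I_n -> {set 'I_n * 'I_n}) :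
  (forall p, (1 <= A h1 p)%N -> (val Z).1 <> shift_mx A h h1 p) ->
  (forall p, P p -> (1 <= A h1 p)%N) ->
  coef_at s Z (\sum_(p < n | P p) x p *: ebasis d (shift_mx A h h1 p) (E p)) = 0.
Proof.
move=> no PA; rewrite coef_at_sum big1 // => p /PA Ap; rewrite coef_at_ebasis.
case: eqP => [E'|_]; last by rewrite mulr0.
by case: (no p Ap); rewrite E'.
Qed.

Variables (P : pred 'I_n) (R : pred 'I_n) (x : 'I_n -> laurent).
Variable E : 'I_n -> 'I_n -> {set 'I_n * 'I_n}.

Lemma coef_at_row2 p : (val Z).1 = shift_mx A h h1 p ->
  coef_at s Z (\sum_(p < n | P p) \sum_(t < n | R t)
     x p *: ebasis d (shift_mx A h h1 p) (E p t))
  = (P p)%:R * (leval s (x p) * \sum_(t < n | R t) ((val Z).2 == E p t)%:R).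
Proof.
move=> ZE; rewrite exchange_big coef_at_sum /= !mulr_sumr; apply: eq_bigr => t _.
exact: coef_at_row ZE.
Qed.

Lemma coef_at_row2_none :
  (forall p, (1 <= A h1 p)%N -> (val Z).1 <> shift_mx A h h1 p) ->
  (forall p, P p -> (1 <= A h1 p)%N) ->
  coef_at s Z (\sum_(p < n | P p) \sum_(t < n | R t)
     x p *: ebasis d (shift_mx A h h1 p) (E p t)) = 0.
Proof.
move=> no PA; rewrite exchange_big coef_at_sum big1 // => t _.
exact: coef_at_row_none.
Qed.

End Coefficients.

(* h and h1 are the rows h and h+1. *)
Theorem proposition4p1p1 (n d : nat) (n_gt0 : (0 < n)%N) (d_gt0 : (0 < d)%N)
    (h h1 : 'I_n) (h1E : h1 = h.+1 :> nat)
    (A B : 'M[nat]_n) (D : {set 'I_n * 'I_n})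
    (BXi : in_Xi d (B, set0)) (AXi : in_Xi d (A, D))
    (roA_coB : ro A = co B)
    (Bdiag : is_diag_mx (map_mx Posz B - delta_mx h h1 : 'M[int]_n)) :
  let A_ (p : 'I_n) := shift_mx A h h1 p in
  [/\ (* (a) *)
      (forall t, (1 <= t <= #|D|)%N ->
         irow D t <> h.+1 /\ irow D t <> h1.+1) ->
      ms_mul (ebasis d B set0) (ebasis d A D) =
        \sum_(p < n | (1 <= A h1 p)%N)
          (vpow (2 * (sum_gt A h p)%:Z) * qnum (A h p).+1) *: ebasis d (A_ p) D,
      (* (b) *)
      forall m, (1 <= m <= #|D|)%N ->
         irow D m = h.+1 -> irow D m.+1 <> h1.+1 ->
      ms_mul (ebasis d B set0) (ebasis d A D) =
        \sum_(p < n | (p.+1 <= jcol D m.+1)%N && (1 <= A h1 p)%N)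
          (vpow (2 * (sum_gt A h p)%:Z) * qnum (A h p).+1) *: ebasis d (A_ p) D
        + \sum_(p < n | (jcol D m.+1 < p.+1 < jcol D m)%N && (1 <= A h1 p)%N)
          (vpow (2 * ((sum_gt A h p)%:Z - 1)) * qnum (A h p).+1) *: ebasis d (A_ p) D
        + \sum_(p < n | (p.+1 == jcol D m) && (1 <= A h1 p)%N)
          (vpow (2 * (sum_gt A h p)%:Z) * qnum (A h p)) *: ebasis d (A_ p) D
        + \sum_(p < n | (jcol D m < p.+1)%N && (1 <= A h1 p)%N)
          (vpow (2 * (sum_gt A h p)%:Z) * qnum (A h p).+1) *: ebasis d (A_ p) D,
      (* (c) *)
      forall m, (1 <= m <= #|D|)%N ->
         irow D m.-1 <> h.+1 -> irow D m = h1.+1 ->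
      let Dc (p : 'I_n) := (D :\ (h1, p)) :|: [set (h, p)] in
      let Dt (p t : 'I_n) := Dc p :|: [set (h1, t)] in
      ms_mul (ebasis d B set0) (ebasis d A D) =
        \sum_(p < n | (1 <= A h1 p)%N)
          (vpow (2 * (sum_gt A h p)%:Z) * qnum (A h p).+1) *: ebasis d (A_ p) D
        + \sum_(p < n | (p.+1 == jcol D m) && (1 <= A h1 p)%N)
          vpow (2 * (sum_ge A h p)%:Z) *: ebasis d (A_ p) (Dc p)
        + \sum_(p < n | (p.+1 == jcol D m) && (1 <= A h1 p)%N)
            \sum_(t < n | (jcol D m.+1 < t.+1 < jcol D m)%N)
          vpow (2 * (sum_ge A h p)%:Z) *: ebasis d (A_ p) (Dt p t)
    & (* (d) *)
      forall m, (1 <= m <= #|D|)%N ->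
         irow D m = h.+1 -> irow D m.+1 = h1.+1 ->
      let Ds (p : 'I_n) := D :\ (h1, p) in
      let Dt (p t : 'I_n) := Ds p :|: [set (h1, t)] in
      ms_mul (ebasis d B set0) (ebasis d A D) =
        \sum_(p < n | ((p.+1 <= jcol D m.+1)%N || (jcol D m < p.+1)%N)
                      && (1 <= A h1 p)%N)
          (vpow (2 * (sum_gt A h p)%:Z) * qnum (A h p).+1) *: ebasis d (A_ p) D
        + \sum_(p < n | (jcol D m.+1 < p.+1 < jcol D m)%N && (1 <= A h1 p)%N)
          (vpow (2 * ((sum_gt A h p)%:Z - 1)) * qnum (A h p).+1) *: ebasis d (A_ p) D
        + \sum_(p < n | (p.+1 == jcol D m) && (1 <= A h1 p)%N)
          (vpow (2 * (sum_gt A h p)%:Z) * qnum (A h p)) *: ebasis d (A_ p) D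
        + \sum_(p < n | (p.+1 == jcol D m.+1) && (1 <= A h1 p)%N)
          (vpow (2 * (sum_ge A h p)%:Z) - vpow (2 * ((sum_gt A h p)%:Z - 1)))
            *: ebasis d (A_ p) (Ds p)
        + \sum_(p < n | (p.+1 == jcol D m.+1) && (1 <= A h1 p)%N)
            \sum_(t < n | (jcol D m.+2 < t.+1 < jcol D m.+1)%N)
          (vpow (2 * (sum_ge A h p)%:Z) - vpow (2 * ((sum_gt A h p)%:Z - 1)))
            *: ebasis d (A_ p) (Dt p t)].
Proof.
rewrite /=.
have aD : antichain D by case/in_XiP: AXi.
have posA x : x \in D -> (0 < A x.1 x.2)%N by case/in_XiP: AXi => _ _; apply.
have reduce c :=
  @product_eq n d h h1 h1E A B roA_coB Bdiag (XiOf BXi) (XiOf AXi) D c erefl erefl.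
have countE q p Z := jump_countE h1E aD q A p (@Xi_antichain n d Z).
split.
- move=> noD; apply: reduce => [s Z s0 no|q Z p q_gt1 Ap ZE].
    by rewrite (coef_at_row_none s0 _ _ no).
  have Jh : stair D h = stair D h1.
    by rewrite h1E; apply: stair_const => // t /noD[].
  have Jh1 : stair D h1 = stair D h1.+1 by apply: stair_const => // t /noD[].
  rewrite (coef_at_row h1E (sqrtC_nat_neq0 q_gt1) _ _ _ ZE) Ap mul1r.
  rewrite countE (no_split h1E _ _ Jh1) mul0n addn0 natrM mulrC Jh.
  rewrite (leval_jump_total q_gt1 h A p); congr (_ * _%:R).
  by case: ltnP => // /jump_through_ge ->.
- move=> m mD mi mi1.
  have [_ J0E J1E J10] := stair_irow aD mD mi; rewrite -J0E -J1E in J10 *.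
  apply: reduce => [s Z s0 no|q Z p q_gt1 Ap ZE].
    by rewrite !coef_atD // !(coef_at_row_none s0 _ _ no) ?addr0 // => p /andP[_].
  have Jh1 : stair D h1 = stair D h1.+1.
    apply: stair_const => // t tD; rewrite h1E.
    by apply: (irow_next aD mD mi) => //; rewrite -h1E.
  have N0 := @tail_pos n h A D p posA J10; rewrite -h1E in J10 *.
  have s0 := sqrtC_nat_neq0 q_gt1.
  rewrite !(coef_atD s0) !(coef_at_row h1E s0 _ _ _ ZE) Ap !andbT.
  rewrite countE (no_split h1E _ _ Jh1) mul0n addn0 natrM [RHS]mulrC.
  exact: (leval_row_values_split q_gt1 (A := A) _ J10 N0).
- move=> m mD mi0 mi.
  have [_ J1E J2E J12] := stair_irow aD mD mi; rewrite -J1E -J2E in J12 *.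
  have Jh : stair D h = stair D h1.
    by rewrite h1E; apply: stair_const => //; apply: (irow_prev aD mD) mi0; rewrite mi h1E.
  apply: reduce => [s Z s0 no|q Z p q_gt1 Ap ZE].
    rewrite !(coef_atD s0) !(coef_at_row_none s0 _ _ no) ?(coef_at_row2_none s0 _ _ _ no);
      by rewrite ?addr0 // => p /andP[_].
  have s0 := sqrtC_nat_neq0 q_gt1.
  rewrite !(coef_atD s0) !(coef_at_row h1E s0 _ _ _ ZE).
  rewrite (coef_at_row2 h1E s0 _ _ _ _ ZE) Ap !andbT.
  rewrite countE natrD !natrM Jh mul1r -addrA; congr (_ + _).
    rewrite (leval_jump_total q_gt1 h A p) mulrC; congr (_ * _%:R).
    by case: ltnP => // /jump_through_ge ->.
  rewrite eq_sym; case: eqP => [J1p|_]; last by rewrite !mul0r addr0.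
  have J2p : (stair D h1.+1 <= p)%N by move: J12; rewrite J1p.
  rewrite !mul1r -mulrDr J1p (leval_missing_eq q_gt1 h A p) mulrC.
  by rewrite (lowered_sum h1E aD J1p J2p (etrans Jh J1p) (@Xi_antichain n d Z)).
- move=> m mD mi mi1.
  have mD1 : (1 <= m.+1 <= #|D|)%N by apply: irow_out; rewrite mi1.
  have [_ J0E _ J10] := stair_irow aD mD mi.
  have [_ J1E J2E J12] := stair_irow aD mD1 mi1; rewrite -J0E -J1E -J2E in J10 J12 *.
  apply: reduce => [s Z s0 no|q Z p q_gt1 Ap ZE].
    rewrite !(coef_atD s0) !(coef_at_row_none s0 _ _ no) ?(coef_at_row2_none s0 _ _ _ no);
      by rewrite ?addr0 // => p /andP[_].
  have N0 : (p.+1 < stair D h)%N -> (0 < tail A h p.+1)%N.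
    by apply: tail_pos posA _; rewrite -h1E.
  have s0 := sqrtC_nat_neq0 q_gt1.
  rewrite !(coef_atD s0) !(coef_at_row h1E s0 _ _ _ ZE).
  rewrite (coef_at_row2 h1E s0 _ _ _ _ ZE) Ap !andbT.
  rewrite countE natrD !natrM -addrA; congr (_ + _).
    by rewrite [RHS]mulrC; exact: (leval_row_values q_gt1 (A := A) _ J10 N0).
  rewrite eq_sym; case: eqP => [J1p|_]; last by rewrite !mul0r addr0.
  have J2p : (stair D h1.+1 <= p)%N by move: J12; rewrite J1p.
  have [jh Jh] : exists jh : 'I_n, stair D h = jh.+1.
    have ltj : ((stair D h).-1 < n)%N by have := stair_le D h; lia.
    by exists (Ordinal ltj); rewrite /=; lia.
  rewrite !mul1r -mulrDr J1p (leval_missing_lt q_gt1 (c := stair D h)) ?N0 -?J1p // mulrC.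
  rewrite J1p (lowered_sum h1E aD J1p J2p Jh (@Xi_antichain n d Z)) /lowered.
  have -> // : D :\ (h1, p) :|: [set (h, jh)] = D :\ (h1, p).
  (* the cell of row h already belongs to D *)
  apply/setUidPl; rewrite sub1set !inE antichain_mem //= -h1E Jh eqxx andbT.
  by rewrite xpair_eqE -!val_eqE /=; lia.
Qed.
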